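(* Let $G$ be an electrical network whose resistance form $(\mathcal E_G,\mathcal F_G)$ is recurrent, and let $B\subseteq V_G$ be non-empty. For any $\rho\in B$, $$P_\rho^G\bigl(\mathrm{tr}_BY_G\in\cdot\bigr)=P_\rho^{G|_B}\bigl(Y_{G|_B}\in\cdot\bigr)$$ as probability measures on $D(\mathbb R_{\ge0},B)$.
   Context: **Electrical networks.** An electrical network $G$ is a connected simple undirected graph with finite or countable vertex set $V_G$, with symmetric conductances $c_G(x,y)\ge0$, positive iff $\{x,y\}$ is an edge, and $c_G(x)=\sum_yc_G(x,y)<\infty$ for all $x$. Its resistance form is $\mathcal E_G(f,g)=\frac12\sum_{x,y}c_G(x,y)(f(x)-f(y))(g(x)-g(y))$ on $\mathcal F_G=\{f:V_G\to\mathbb R:\mathcal E_G(f,f)<\infty\}$. $Y_G=(Y_G(k))_{k\ge0}$ is the discrete-time Markov chain on $V_G$ with transition probabilities $c_G(x,y)/c_G(x)$, with law $P_x^G$ when started at $x$, and $Y_G(t)=Y_G(\lfloor t\rfloor)$ for $t\ge0$ (for a network with a single vertex the chain is constant). $D(\mathbb R_{\ge0},B)$ is the space of cadlag functions from $[0,\infty)$ to $B$ (discrete topology) with the $J_1$-Skorohod topology. **Recurrence.** For $A,A'\subseteq V_G$, $R_G(A,A')=\bigl(\inf\{\mathcal E_G(f,f):f\in\mathcal F_G,f|_A=1,f|_{A'}=0\}\bigr)^{-1}$ ($0$ if no such $f$, $\infty$ if the infimum is $0$). $(\mathcal E_G,\mathcal F_G)$ is recurrent if there is an increasing sequence of finite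 sets $U_n$ with $\bigcup_nU_n=V_G$ and $R_G(\{\rho\},U_n^c)\to\infty$ for some $\rho\in V_G$. **Trace network.** $\mathcal E_G|_B(\varphi,\psi)=\mathcal E_G(h_B(\varphi),h_B(\psi))$ for $\varphi,\psi\in\{u|_B:u\in\mathcal F_G\}$, where $h_B(\varphi)$ is the unique minimizer of $\mathcal E_G(u,u)$ among $u\in\mathcal F_G$ with $u|_B=\varphi$. The trace $G|_B$ is the electrical network with vertex set $B$, conductances $c_{G|_B}(x,y)=-\mathcal E_G|_B(1_{\{x\}},1_{\{y\}})$ for $x\ne y$ and $c_{G|_B}(x,x)=0$, and edges the pairs with positive conductance. **Trace of the chain.** Set $\tilde T_B^{(0)}=0$ and $\tilde T_B^{(k+1)}=\inf\{n\ge\tilde T_B^{(k)}+1:Y_G(n)\in B\setminus\{Y_G(\tilde T_B^{(k)})\}\}$, with $\tilde T_B^{(k+1)}=\tilde T_B^{(k)}$ if the set is empty. For $Y_G(0)\in B$, $\mathrm{tr}_BY_G(k)=Y_G(\tilde T_B^{(k)})$ and $\mathrm{tr}_BY_G(t)=\mathrm{tr}_BY_G(\lfloor t\rfloor)$. *)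

(* Defs.v *)
From HB Require Import structures.
From mathcomp Require Import all_boot all_order all_algebra.
From mathcomp Require Import all_classical all_reals all_analysis.

Set Implicit Arguments.
Unset Strict Implicit.
Unset Printing Implicit Defensive.

Import Order.TTheory GRing.Theory Num.Theory.

Local Open Scope classical_set_scope.
Local Open Scope ring_scope.

Section Network.
Context {R : realType} {V : countType}.
Implicit Types (c : V -> V -> R) (f g u : V -> R).

Definition total_conductance c (x : V) : \bar R :=
  (\esum_(y in [set: V]) (c x y)%:E)%E.

(* A network is given by its conductances: the edges of the graph are the pairs
   {x, y} with [0 < c x y]. *)
Record electrical_network c : Prop := {
  conductance_ge0 : forall x y, 0 <= c x y;
  conductance_sym : forall x y, c x y = c y x;
  conductance_loopless : forall x, c x x = 0;
  total_conductance_fin : forall x, (total_conductance c x < +oo)%E;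
  network_connected : forall x y, exists2 s : seq V,
    path (fun a b => 0 < c a b) x s & last x s = y
}.

(* The sum over V x V is split into positive and negative parts; both sums are
   finite when f and g have finite energy, and the negative one vanishes when
   f = g. *)
Definition resistance_form c f g : \bar R :=
  let F (p : V * V) : \bar R :=
    (c p.1 p.2 * (f p.1 - f p.2) * (g p.1 - g p.2))%:E in
  (2^-1%:E * (\esum_(p in [set: V * V]) (F^\+ p)
              - \esum_(p in [set: V * V]) (F^\- p)))%E.

Definition form_domain c : set (V -> R) :=
  [set f | (resistance_form c f f < +oo)%E].

(* In [\bar R], the infimum of the empty set is +oo, +oo^-1 = 0 and
   0^-1 = +oo. *)
Definition effective_resistance c (A A' : set V) : \bar R :=
  let potentials := [set f | [/\ form_domain c f, (forall x, A x -> f x = 1)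
                                & (forall x, A' x -> f x = 0)]] in
  ((ereal_inf [set resistance_form c f f | f in potentials])^-1)%E.

Definition recurrent c : Prop :=
  exists (U : nat -> set V) (rho : V),
    [/\ (forall n, finite_set (U n)),
        (forall m n, (m <= n)%N -> U m `<=` U n),
        \bigcup_n U n = [set: V]
      & effective_resistance c [set rho] (~` U n) @[n --> \oo] --> +oo%E].

Definition energy_minimizer c (B : set V) (phi : B -> R) : set (V -> R) :=
  [set u | [/\ form_domain c u, (forall x : B, u (val x) = phi x)
     & forall v, form_domain c v -> (forall x : B, v (val x) = phi x) ->
         (resistance_form c u u <= resistance_form c v v)%E]].

(* The default value 0 is used only if there is no minimizer. *)
Definition energy_extension c (B : set V) (phi : B -> R) : V -> R :=
  xget (fun=> 0) (energy_minimizer c phi).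

Definition trace_form c (B : set V) (phi psi : B -> R) : \bar R :=
  resistance_form c (energy_extension c phi) (energy_extension c psi).

Definition trace_conductance c (B : set V) (x y : B) : R :=
  if x == y then 0
  else - fine (trace_form c (\1_[set x] : B -> R) (\1_[set y] : B -> R)).

(* In a network, [total_conductance c x = 0] means that x is the only vertex. *)
Definition transition c (x y : V) : R :=
  if total_conductance c x == 0%E then (x == y)%:R
  else c x y / fine (total_conductance c x).

(* Y realizes, on the probability space (Omega, P), the chain with transition
   probabilities [transition c] started at x; the Markov property is multiplied
   out by the probability of the conditioning event. *)
Record markov_chain c (x : V) (d : measure_display) (Omega : measurableType d)
    (P : probability Omega R) (Y : nat -> Omega -> V) : Prop := {
  chain_measurable : forall n (A : set V), measurable (Y n @^-1` A);
  chain_start : P (Y 0 @^-1` [set x]) = 1%E;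
  chain_step : forall n (v : nat -> V),
    P [set w | forall i, (i <= n.+1)%N -> Y i w = v i] =
    (P [set w | forall i, (i <= n)%N -> Y i w = v i]
     * (transition c (v n) (v n.+1))%:E)%E
}.

End Network.

Section TraceChain.
Context {V : countType} (B : set V).
Implicit Type y : nat -> V.

Fixpoint trace_time y (k : nat) : nat :=
  if k is k'.+1 then
    let m := trace_time y k' in
    if pselect (exists n, [&& (m < n)%N, y n \in B & y n != y m]) is left ex
    then ex_minn ex else m
  else 0%N.

(* When [y 0] is in B, so is every [y (trace_time y k)], and the default rho is
   never used. *)
Definition trace_chain (rho : B) y (k : nat) : B :=
  insubd rho (y (trace_time y k)).

End TraceChain.

Section Skorohod.
Context {R : realType}.

Definition cadlag {B : Type} (f : {nonneg R} -> B) : Prop :=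
  (forall t, exists2 d : R, 0 < d &
     forall s, t <= s -> s%:num < t%:num + d -> f s = f t) /\
  (forall t, 0 < t%:num -> exists b, exists2 d : R, 0 < d &
     forall s, t%:num - d < s%:num -> s < t -> f s = b).

Record skorohod (B : Type) := Skorohod {
  path_of :> {nonneg R} -> B;
  path_cadlag : cadlag path_of
}.

HB.instance Definition _ B := gen_eqMixin (skorohod B).
HB.instance Definition _ B := gen_choiceMixin (skorohod B).

Definition time_change (lam : {nonneg R} -> {nonneg R}) : Prop :=
  {homo lam : s t / s < t} /\ (forall t, exists s, lam s = t).

Section J1.
Context {B : Type}.

(* Base of neighbourhoods of f for the J1 topology on D([0,oo), B): y_n -> f iff,
   for each T, there are time changes lam_n such that |lam_n t - t| and the
   distance from y_n t to f (lam_n t) tend to 0 uniformly on [0, T]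
   (Ethier-Kurtz, Markov Processes, Prop. 3.5.3). B carries the discrete metric,
   hence the equality. *)
Definition J1_ball (f : skorohod B) (T eps : R) : set (skorohod B) :=
  [set g | exists2 lam, time_change lam &
     forall t, t%:num <= T ->
       `|(lam t)%:num - t%:num| < eps /\ g t = f (lam t)].

Definition J1_open : set (set (skorohod B)) :=
  [set U | forall f, U f ->
     exists T eps : R, 0 < eps /\ J1_ball f T eps `<=` U].

Lemma J1_openT : J1_open setT.
Proof. by move=> f _; exists 0, 1; split. Qed.

Lemma J1_openI : setI_closed J1_open.
Proof.
move=> U W oU oW f [/oU[T1 [e1 [e10 UT]]] /oW[T2 [e2 [e20 WT]]]].
exists (Num.max T1 T2), (Num.min e1 e2); split.
  by rewrite lt_min e10 e20.
move=> g [lam lamP gf]; split; [apply: UT|apply: WT]; exists lam => // t tT.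
- have [|] := gf t; first by rewrite le_max tT.
  by rewrite lt_min => /andP[].
- have [|] := gf t; first by rewrite le_max tT orbT.
  by rewrite lt_min => /andP[].
Qed.

Lemma J1_open_bigU (I : Type) (U : I -> set (skorohod B)) :
  (forall i, J1_open (U i)) -> J1_open (\bigcup_i U i).
Proof.
move=> oU f [i _ /oU[T [e [e0 TU]]]].
by exists T, e; split => // g /TU ?; exists i.
Qed.

HB.instance Definition _ :=
  isOpenTopological.Build (skorohod B) J1_openT J1_openI J1_open_bigU.

Definition skorohod_borel : set (set (skorohod B)) :=
  <<s (@open (skorohod B)) >>.

Lemma step_cadlag (y : nat -> B) :
  cadlag (fun t : {nonneg R} => y (Num.truncn t%:num)).
Proof.
split=> t.
- set m := Num.truncn t%:num.
  have /andP[tl tu] : m%:R <= t%:num < m.+1%:R by exact: truncn_itv.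
  exists (m.+1%:R - t%:num); first by rewrite subr_gt0.
  move=> s ts; rewrite addrC subrK => st; congr y; apply: truncn_def.
  by rewrite st andbT (le_trans tl).
- move=> t0; set m := Num.truncn t%:num.
  have /andP[tl tu] : m%:R <= t%:num < m.+1%:R by exact: truncn_itv.
  have [tm|tm] := ltP m%:R t%:num.
    exists (y m), (t%:num - m%:R); first by rewrite subr_gt0.
    move=> s; rewrite subKr => ms st; congr y; apply: truncn_def.
    by rewrite (ltW ms) (lt_trans _ tu).
  exists (y m.-1), 1 => // s ts st; congr y; apply: truncn_def.
  have te : t%:num = m%:R by apply/eqP; rewrite eq_le tm tl.
  have m0 : (0 < m)%N by rewrite -(ltr0n R) -te.
  rewrite prednK//; apply/andP; split; last by rewrite -te.
  by rewrite -subn1 natrB// ltW// -te.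
Qed.

Definition step_path (y : nat -> B) : skorohod B := Skorohod (step_cadlag y).

End J1.
End Skorohod.
Arguments skorohod R B : clear implicits.
Arguments skorohod_borel R B : clear implicits.

Section Law.
Context {R : realType} {B : Type}.

Definition random_path (d : measure_display) (Omega : measurableType d)
    (X : Omega -> skorohod R B) : Prop :=
  forall A, skorohod_borel R B A -> measurable (X @^-1` A).

Definition same_law (d : measure_display) (Omega : measurableType d)
    (P : probability Omega R) (X : Omega -> skorohod R B)
    (d' : measure_display) (Omega' : measurableType d')
    (P' : probability Omega' R) (X' : Omega' -> skorohod R B) : Prop :=
  [/\ random_path X, random_path X' &
      forall A, skorohod_borel R B A -> P (X @^-1` A) = P' (X' @^-1` A)].

End Law.

(* Main.v *)
Require Import Defs.
From HB Require Import structures.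
From mathcomp Require Import all_boot all_order all_algebra.
From mathcomp Require Import all_classical all_reals all_analysis.
From mathcomp Require Import ring lra.

(* Write P for the transition operator, D for a set of vertices and h_x(z) for the
   probability that the chain started at z first visits D at x.  Recurrence gives
   finitely supported cutoffs f with values in [0,1], of arbitrarily small energy
   and close to 1 at any given vertex.  Picone's inequality, i.e. testing a
   superharmonic g >= 1 against f^2/g, shows that bounded superharmonic functions
   are harmonic; hence a bounded function which vanishes on D and is harmonic off D
   is 0.  Approximating h_x by the probabilities of hitting within n steps, and the
   competitors v by v f, Green's formula shows that h_x is the energy minimizer with
   boundary values 1_x on B = D, so that the conductance of the trace between x and
   y is c(y) (P h_x)(y).  Since the first return to B is almost surely finite, the
   maximum principle gives sum_x h_x = 1 and expresses the law of the first visit to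
   B \ {u} from u through the returns to B: this law is exactly the transition
   probability of the trace network.  The Markov property at the times of the trace
   then identifies the finite-dimensional distributions, and J1-open sets of step
   paths are countable unions of cylinders. *)

Set Implicit Arguments.
Unset Strict Implicit.
Unset Printing Implicit Defensive.

Import Order.TTheory GRing.Theory Num.Theory.
Import numFieldNormedType.Exports.

Local Open Scope classical_set_scope.
Local Open Scope ring_scope.

(** * Signed sums *)

(** Vertices may have infinite degree, and [hit D x] is in general not integrable against
    [vertex_weight], so Green's formula cannot be applied with it as test function. An integrable
    factor is supplied each time: the approximations within n steps (upper bound of the energy), a
    competitor times a cutoff (lower bound), a point mass (off-diagonal conductances).

    The trace records only changes of vertex and its network has no loops, whereas the first return
    to [B] from [u] may be at [u] itself. The conductances at [u] add up to the weight of [u] times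
    1 minus the probability of this loop; normalizing by that sum accounts for the discarded
    returns.

    Almost sure existence of the next trace move is not shown for the chain directly. The event that
    the trace follows a word by genuine moves has the probability of that word in the trace network
    and implies that the trace chain spells the word; word probabilities sum to 1 on both sides, so
    all these inequalities are equalities. A trace network of weight 0, which has one vertex and no
    move, is treated apart. *)

Section RealSums.
Context {R : realType}.

Section OneType.
Context {T : choiceType}.
Implicit Types F G : T -> R.

Definition summ F : Prop := summable [set: T] (EFin \o F).

(* A signed sum, meaningful only when [summ F]. *)
Definition rsum F : R :=
  fine (esum [set: T] ((EFin \o F)^\+)%E - esum [set: T] ((EFin \o F)^\-)%E)%E.

Lemma summ_le G F : (forall x, `|F x| <= G x) -> summ G -> summ F.
Proof.
move=> FG; apply: le_lt_trans; apply: le_esum => x _ /=.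
by rewrite lee_fin (le_trans (FG x))// ler_norm.
Qed.

Lemma esum_norm F : (forall x, 0 <= F x) ->
  (\esum_(x in [set: T]) `|(F x)%:E| = \esum_(x in [set: T]) (F x)%:E)%E.
Proof. by move=> F0; apply: eq_esum => x _ /=; rewrite ger0_norm. Qed.

Lemma summ_fin F : (forall x, 0 <= F x) ->
  (\esum_(x in [set: T]) (F x)%:E < +oo)%E -> summ F.
Proof. by move=> F0; rewrite /summ /summable /= esum_norm. Qed.

Lemma rsum_fin F : (forall x, 0 <= F x) -> summ F ->
  (\esum_(x in [set: T]) (F x)%:E = (rsum F)%:E)%E.
Proof.
move=> F0 sF; rewrite /rsum.
have -> : esum [set: T] ((EFin \o F)^\-)%E = 0%E.
  by apply: esum1 => x _; rewrite funenegE; apply/max_idPr; rewrite lee_fin oppr_le0.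
have -> : esum [set: T] ((EFin \o F)^\+)%E = (\esum_(x in [set: T]) (F x)%:E)%E.
  by apply: eq_esum => x _; rewrite funeposE; apply/max_idPl; rewrite lee_fin.
rewrite sube0 fineK// ge0_fin_numE; last by apply: esum_ge0 => x _; rewrite lee_fin.
by move: sF; rewrite /summ /summable /= esum_norm.
Qed.

Lemma eq_rsum F G : (forall x, F x = G x) -> rsum F = rsum G.
Proof. by move=> FG; have -> : F = G by apply/funext. Qed.

Lemma eq_summ F G : (forall x, F x = G x) -> summ G -> summ F.
Proof. by move=> FG; have -> : F = G by apply/funext. Qed.

Lemma summ_norm F : summ F -> summ (fun x => `|F x|).
Proof.
move=> sF; apply: le_lt_trans sF; apply: le_esum => x _ /=.
by rewrite normr_id.
Qed.

Lemma summD F G : summ F -> summ G -> summ (fun x => F x + G x).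
Proof. exact: summableD. Qed.

Lemma summN F : summ F -> summ (fun x => - F x).
Proof. by move/summ_norm; apply: summ_le => x; rewrite normrN. Qed.

Lemma summB F G : summ F -> summ G -> summ (fun x => F x - G x).
Proof. by move=> sF sG; apply: summD => //; apply: summN. Qed.

(** One inequality is enough: [rsumZ] gets the other by applying it to the inverse factor. *)
Lemma esumZl (k : R) F : 0 <= k -> (forall x, 0 <= F x) ->
  (\esum_(x in [set: T]) (k * F x)%:E <= k%:E * \esum_(x in [set: T]) (F x)%:E)%E.
Proof.
move=> k0 F0; apply: ge_ereal_sup => _ [X [finX XI] <-].
have -> : (\sum_(x \in X) (k * F x)%:E = k%:E * \sum_(x \in X) (F x)%:E)%E.
  by rewrite !fsbig_finite//= !sumEFin -EFinM mulr_sumr.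
apply: lee_wpmul2l; first by rewrite lee_fin.
by apply: ereal_sup_ubound; exists X.
Qed.

Lemma summZ (k : R) F : summ F -> summ (fun x => k * F x).
Proof.
move=> sF; rewrite /summ /summable.
rewrite (@eq_esum _ _ _ _ (fun x => (`|k| * `|F x|)%:E)%E); last first.
  by move=> x _ /=; rewrite normrM.
apply: (le_lt_trans (esumZl _ _)) => //.
have : summ F by []. rewrite /summ summableE => /fineK <-.
by rewrite -EFinM ltry.
Qed.

Lemma rsumB_ge0 F G : (forall x, 0 <= F x) -> (forall x, 0 <= G x) ->
  summ F -> summ G -> rsum (fun x => F x - G x) = rsum F - rsum G.
Proof.
move=> F0 G0 sF sG.
rewrite {1}/rsum.
have -> : EFin \o (fun x => F x - G x) = ((EFin \o F) \- (EFin \o G))%E.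
  by apply/funext => x /=; rewrite EFinB.
rewrite esumB//; try by move=> x _ /=; rewrite lee_fin.
by rewrite -[\esum_(i in _) (EFin \o F) i]/(\esum_(i in _) (F i)%:E)
  -[\esum_(i in _) (EFin \o G) i]/(\esum_(i in _) (G i)%:E) !rsum_fin.
Qed.

Let pos F x := Num.max (F x) 0.
Let neg F x := Num.max (- F x) 0.

Let pos0 F x : 0 <= pos F x. Proof. by rewrite le_max lexx orbT. Qed.
Let neg0 F x : 0 <= neg F x. Proof. by rewrite le_max lexx orbT. Qed.
Let posneg F x : F x = pos F x - neg F x.
Proof.
rewrite /pos/neg; have [h|/ltW h] := leP 0 (F x).
  by rewrite max_r ?subr0// oppr_le0.
by rewrite max_l ?oppr_ge0// sub0r opprK.
Qed.
Let pos_le F x : `|pos F x| <= `|F x|.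
Proof. by rewrite /pos; have [h|h] := leP 0 (F x); rewrite ?normr0. Qed.
Let neg_le F x : `|neg F x| <= `|F x|.
Proof. by rewrite /neg; have [h|h] := leP 0 (- F x); rewrite ?normr0 ?normrN. Qed.

Let summ_pos F : summ F -> summ (pos F).
Proof. by move/summ_norm; apply: summ_le. Qed.
Let summ_neg F : summ F -> summ (neg F).
Proof. by move/summ_norm; apply: summ_le. Qed.

Let rsumpn F : summ F -> rsum F = rsum (pos F) - rsum (neg F).
Proof.
move=> sF; rewrite -rsumB_ge0//; [|exact: summ_pos|exact: summ_neg].
by apply: eq_rsum.
Qed.

Let rsumD_ge0 F G : (forall x, 0 <= F x) -> (forall x, 0 <= G x) ->
  summ F -> summ G -> rsum (fun x => F x + G x) = rsum F + rsum G.
Proof.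
move=> F0 G0 sF sG; apply: EFin_inj.
rewrite EFinD -!rsum_fin//; [|by move=> x; exact: addr_ge0|exact: summD].
by rewrite -esumD// => x _; rewrite lee_fin.
Qed.

Lemma rsumD F G : summ F -> summ G ->
  rsum (fun x => F x + G x) = rsum F + rsum G.
Proof.
move=> sF sG; rewrite (rsumpn sF) (rsumpn sG).
rewrite (@eq_rsum _ (fun x => (pos F x + pos G x) - (neg F x + neg G x))); last first.
  by move=> x; rewrite [F x]posneg [G x]posneg; lra.
rewrite rsumB_ge0.
- rewrite !rsumD_ge0//; [lra|exact: summ_neg|exact: summ_neg|exact: summ_pos|exact: summ_pos].
- by move=> x; rewrite addr_ge0.
- by move=> x; rewrite addr_ge0.
- by apply: summD; exact: summ_pos.
- by apply: summD; exact: summ_neg.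
Qed.

Lemma rsum0 : rsum (fun=> 0) = 0.
Proof.
by rewrite /rsum !esum1 ?sube0//= => x _; rewrite ?funeposE ?funenegE /= ?oppr0 maxxx.
Qed.

Lemma summ0 : summ (fun=> 0).
Proof. by rewrite /summ /summable esum1//= => x _; rewrite normr0. Qed.

Lemma rsumN F : summ F -> rsum (fun x => - F x) = - rsum F.
Proof.
move=> sF; apply/eqP; rewrite -addr_eq0 -rsumD//; last exact: summN.
by rewrite (@eq_rsum _ (fun=> 0)) ?rsum0// => x; rewrite addNr.
Qed.

Lemma rsumB F G : summ F -> summ G ->
  rsum (fun x => F x - G x) = rsum F - rsum G.
Proof. by move=> sF sG; rewrite rsumD ?rsumN//; exact: summN. Qed.

Lemma rsum_ge0 F : (forall x, 0 <= F x) -> 0 <= rsum F.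
Proof.
move=> F0; rewrite /rsum.
have -> : esum [set: T] ((EFin \o F)^\-)%E = 0%E.
  by apply: esum1 => x _; rewrite funenegE; apply/max_idPr; rewrite lee_fin oppr_le0.
by rewrite sube0 fine_ge0// esum_ge0.
Qed.

Lemma ler_rsum F G : summ F -> summ G -> (forall x, F x <= G x) ->
  rsum F <= rsum G.
Proof.
move=> sF sG FG; rewrite -subr_ge0 -rsumB//; apply: rsum_ge0 => x.
by rewrite subr_ge0.
Qed.

Lemma rsum_le F (C : R) : (forall x, 0 <= F x) ->
  (\esum_(x in [set: T]) (F x)%:E <= C%:E)%E -> summ F /\ rsum F <= C.
Proof.
move=> F0 FC; have sF : summ F by apply: summ_fin => //; rewrite (le_lt_trans FC)// ltry.
by split => //; rewrite -lee_fin -rsum_fin.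
Qed.

Lemma rsumZ (k : R) F : summ F -> rsum (fun x => k * F x) = k * rsum F.
Proof.
move=> sF.
have ge0Z (l : R) G : 0 <= l -> (forall x, 0 <= G x) -> summ G ->
    rsum (fun x => l * G x) = l * rsum G.
  move=> l0 G0 sG.
  have le m H : 0 <= m -> (forall x, 0 <= H x) -> summ H ->
      rsum (fun x => m * H x) <= m * rsum H.
    move=> m0 H0 sH; rewrite -lee_fin EFinM -!rsum_fin//; [exact: esumZl|..].
      by move=> x; rewrite mulr_ge0.
    exact: summZ.
  apply/eqP; rewrite eq_le le//=.
  have [->|ln0] := eqVneq l 0.
    by rewrite mul0r rsum_ge0// => x; rewrite mul0r.
  rewrite -ler_pdivlMl ?lt_def ?ln0// (le_trans _ (le l^-1 _ _ _ _))//.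
  - by rewrite le_eqVlt; apply/orP; left; apply/eqP/eq_rsum => x; rewrite mulKf.
  - by rewrite invr_ge0.
  - by move=> x; rewrite mulr_ge0.
  - exact: summZ.
have Zpos l G : 0 <= l -> summ G -> rsum (fun x => l * G x) = l * rsum G.
  move=> l0 sG; rewrite (rsumpn sG) mulrBr -!ge0Z//; [|exact: summ_neg|exact: summ_pos].
  rewrite -rsumB; [|by apply: summZ; exact: summ_pos|by apply: summZ; exact: summ_neg].
  by apply: eq_rsum => x; rewrite -mulrBr -posneg.
have [k0|k0] := leP 0 k; first exact: Zpos.
rewrite -[k in RHS]opprK mulNr -Zpos// ?oppr_ge0 ?(ltW k0)// -rsumN; last exact: summZ.
by apply: eq_rsum => x; rewrite mulNr opprK.
Qed.

Lemma ler_norm_rsum F : summ F -> `|rsum F| <= rsum (fun x => `|F x|).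
Proof.
move=> sF; have sn := summ_norm sF; rewrite ler_norml; apply/andP; split.
  rewrite -rsumN//; apply: ler_rsum => //; first exact: summN.
  by move=> x; rewrite lerNl -normrN ler_norm.
by apply: ler_rsum => // x; rewrite ler_norm.
Qed.

Lemma esum_ge_term (F : T -> \bar R) x : (forall x, (0 <= F x)%E) ->
  (F x <= \esum_(y in [set: T]) F y)%E.
Proof.
move=> F0; rewrite esum_ge//; exists [set x]; first by split.
by rewrite fsbig_set1.
Qed.

Lemma term_le_rsum F x : (forall x, 0 <= F x) -> summ F -> F x <= rsum F.
Proof.
move=> F0 sF; rewrite -lee_fin -rsum_fin//.
by apply: (@esum_ge_term (fun x => (F x)%:E)) => y; rewrite lee_fin.
Qed.

Lemma summ_supp1 F x : (forall y, y != x -> F y = 0) -> summ F.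
Proof.
move=> F0; rewrite /summ /summable.
rewrite (@eq_esum _ _ _ _ (fun y => if y \in [set x] then `|(F y)%:E| else 0)%E); last first.
  move=> y _ /=; case: ifPn => //; rewrite notin_setE /= => /eqP yx.
  by rewrite F0 ?normr0.
by rewrite -esum_mkcond esum_set1// ltry.
Qed.

Lemma rsum_supp1 F x : (forall y, y != x -> F y = 0) -> rsum F = F x.
Proof.
have ge0 G : (forall y, 0 <= G y) -> (forall y, y != x -> G y = 0) -> rsum G = G x.
  move=> G0 Gx; apply: EFin_inj; rewrite -rsum_fin//; last exact: summ_supp1 Gx.
  rewrite (@eq_esum _ _ _ _ (fun y => if y \in [set x] then (G y)%:E else 0)%E).
    by rewrite -esum_mkcond esum_set1// lee_fin.
  move=> y _ /=; case: ifPn => //; rewrite notin_setE /= => /eqP yx.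
  by rewrite Gx.
move=> Fx; have sF := summ_supp1 Fx.
rewrite rsumpn// !ge0// -?posneg// => y /Fx; rewrite /pos /neg => ->;
  by rewrite ?oppr0 maxxx.
Qed.

(** Every finite partial sum of [F] is a limit of finite partial sums bounded by [C]. This transfers
    energies, averages and total masses from [hit_within] to [hit]. *)
Lemma fatou_rsum (Fn : nat -> T -> R) F (C : R) :
  (forall n x, 0 <= Fn n x) -> (forall n, summ (Fn n)) ->
  (forall n, rsum (Fn n) <= C) ->
  (forall x, Fn n x @[n --> \oo] --> F x) ->
  summ F /\ rsum F <= C.
Proof.
move=> Fn0 sFn FnC FnF.
have F0 x : 0 <= F x.
  by apply: (cvgr_to_ge (FnF x)); apply: nearW.
apply: rsum_le => //; apply: ge_ereal_sup => _ [X [finX _] <-].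
rewrite fsbig_finite//= sumEFin lee_fin.
have cv (r : seq T) : (\sum_(x <- r) Fn n x) @[n --> \oo] --> \sum_(x <- r) F x.
  elim: r => [|x r IH].
    by under eq_fun do rewrite big_nil; rewrite big_nil; apply: cvg_cst.
  under eq_fun do rewrite big_cons.
  by rewrite big_cons; apply: cvgD.
apply: (cvgr_to_le (cv _)); apply: nearW => n.
rewrite (le_trans _ (FnC n))// -lee_fin -rsum_fin//.
apply: ereal_sup_ubound; exists X => //.
by rewrite fsbig_finite//= sumEFin.
Qed.

End OneType.

(** * Double sums: Tonelli and Fubini *)

Section Pairs.
Context {T1 T2 : choiceType}.
Implicit Types F : T1 * T2 -> R.

Let pairT : [set: T1] `*`` (fun=> [set: T2]) = [set: T1 * T2].
Proof. by apply/seteqP; split. Qed.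

Lemma esum_pair F : (forall p, 0 <= F p) ->
  (\esum_(p in [set: T1 * T2]) (F p)%:E =
   \esum_(x in [set: T1]) \esum_(y in [set: T2]) (F (x, y))%:E)%E.
Proof.
move=> F0; rewrite esum_esum; last by move=> *; rewrite lee_fin.
by rewrite pairT; apply: eq_esum => -[].
Qed.

Lemma summ_slice F x : summ F -> summ (fun y => F (x, y)).
Proof.
move=> /summ_norm sF; apply: (@summ_le _ (fun y => `|F (x, y)|)) => //.
apply: summ_fin => //.
have := sF; rewrite /summ /summable esum_norm// esum_pair//.
apply: le_lt_trans.
apply: (@esum_ge_term _ (fun x => \esum_(y in [set: T2]) `|F (x, y)|%:E)%E) => z.
by apply: esum_ge0 => *; rewrite lee_fin.
Qed.

Lemma summ_pair F : (forall p, 0 <= F p) ->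
  (forall x, summ (fun y => F (x, y))) ->
  summ (fun x => rsum (fun y => F (x, y))) -> summ F.
Proof.
move=> F0 s1 s2; apply: summ_fin => //; rewrite esum_pair//.
under eq_esum do rewrite rsum_fin//.
by rewrite rsum_fin// ?ltry// => x; apply: rsum_ge0.
Qed.

Let rsum_pair_ge0 F : (forall p, 0 <= F p) -> summ F ->
  summ (fun x => rsum (fun y => F (x, y))) /\
  rsum F = rsum (fun x => rsum (fun y => F (x, y))).
Proof.
move=> F0 sF.
have E : (\esum_(p in [set: T1 * T2]) (F p)%:E =
    \esum_(x in [set: T1]) (rsum (fun y => F (x, y)))%:E)%E.
  rewrite esum_pair//; apply: eq_esum => x _; rewrite rsum_fin//.
  exact: summ_slice.
have r0 x : 0 <= rsum (fun y => F (x, y)) by apply: rsum_ge0.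
have s2 : summ (fun x => rsum (fun y => F (x, y))).
  by apply: summ_fin => //; rewrite -E rsum_fin// ltry.
by split => //; apply: EFin_inj; rewrite -!rsum_fin.
Qed.

Let pos F x := Num.max (F x) 0.
Let neg F x := Num.max (- F x) 0.

Lemma rsum_pair F : summ F ->
  summ (fun x => rsum (fun y => F (x, y))) /\
  rsum F = rsum (fun x => rsum (fun y => F (x, y))).
Proof.
move=> sF; have sN := summ_norm sF.
have sp : summ (pos F).
  by apply: summ_le sN => p; rewrite /pos; have [h|h] := leP 0 (F p); rewrite ?normr0.
have sn : summ (neg F).
  by apply: summ_le sN => p; rewrite /neg; have [h|h] := leP 0 (- F p); rewrite ?normr0 ?normrN.
have p0 p : 0 <= pos F p by rewrite le_max lexx orbT.
have n0 p : 0 <= neg F p by rewrite le_max lexx orbT.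
have E p : F p = pos F p - neg F p.
  rewrite /pos/neg; have [h|/ltW h] := leP 0 (F p).
    by rewrite max_r ?subr0// oppr_le0.
  by rewrite max_l ?oppr_ge0// sub0r opprK.
have [s1 e1] := rsum_pair_ge0 p0 sp; have [s2 e2] := rsum_pair_ge0 n0 sn.
have E2 x : rsum (fun y => F (x, y)) =
    rsum (fun y => pos F (x, y)) - rsum (fun y => neg F (x, y)).
  by rewrite -rsumB; [apply: eq_rsum => y|exact: summ_slice|exact: summ_slice].
split.
  by apply: (eq_summ E2); apply: summB.
by rewrite (eq_rsum E) rsumB// e1 e2 (eq_rsum E2) rsumB.
Qed.

End Pairs.

Lemma summ_swap (T1 T2 : choiceType) (F : T1 * T2 -> R) :
  summ F -> summ (fun q => F (q.2, q.1)).
Proof.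
rewrite /summ /summable => h.
rewrite (reindex_esum [set: T1 * T2] _ (fun q => (q.2, q.1)))//=.
  by apply: le_lt_trans h; apply: le_esum => -[].
split => //=; first by move=> [? ?] [? ?] _ _ [-> ->].
by move=> [x y] _; exists (y, x).
Qed.

Lemma rsum_swap (T1 T2 : choiceType) (F : T1 * T2 -> R) :
  rsum (fun q => F (q.2, q.1)) = rsum F.
Proof.
have e (f : T1 * T2 -> \bar R) : esum [set: T1 * T2] f =
    esum [set: T2 * T1] (fun q => f (q.2, q.1)).
  rewrite (reindex_esum [set: T2 * T1] _ (fun q => (q.2, q.1)))//=.
  split => //=; first by move=> [? ?] [? ?] _ _ [-> ->].
  by move=> [x y] _; exists (y, x).
rewrite /rsum !e; congr fine; congr (_ - _)%E.
  by apply: eq_esum => q _; rewrite !funeposE.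
by apply: eq_esum => q _; rewrite !funenegE.
Qed.

Lemma rsum_exchange (T1 T2 : choiceType) (F : T1 -> T2 -> R) :
  summ (fun p => F p.1 p.2) ->
  rsum (fun x => rsum (F x)) = rsum (fun y => rsum (F ^~ y)).
Proof.
move=> sF; have [_ <-] := rsum_pair sF.
by have [_ <-] := rsum_pair (summ_swap sF); rewrite (rsum_swap (fun p => F p.1 p.2)).
Qed.

End RealSums.

(** * Energy and Green's formula *)

Section Networks.
Context {R : realType} {V : countType}.
Variable c : V -> V -> R.
Implicit Types f g h u v phi : V -> R.

Definition vertex_weight (x : V) : R := fine (total_conductance c x).

(** The transition operator, written P in the overview. *)
Definition average f (x : V) : R := rsum (fun y => transition c x y * f y).

Definition energy f g : R :=
  2^-1 * rsum (fun p => c p.1 p.2 * (f p.1 - f p.2) * (g p.1 - g p.2)).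

Definition finite_energy f : Prop :=
  summ (fun p => c p.1 p.2 * (f p.1 - f p.2) * (f p.1 - f p.2)).

Hypothesis hG : electrical_network c.

Let c0 x y : 0 <= c x y. Proof. exact: conductance_ge0 hG x y. Qed.
Let cC x y : c x y = c y x. Proof. exact: conductance_sym hG x y. Qed.

Lemma total_conductance_ge0 x : (0 <= total_conductance c x)%E.
Proof. by apply: esum_ge0 => y _; rewrite lee_fin. Qed.

Lemma total_conductanceE x : total_conductance c x = (vertex_weight x)%:E.
Proof.
rewrite /vertex_weight fineK// ge0_fin_numE; last exact: total_conductance_ge0.
exact: total_conductance_fin hG x.
Qed.

Lemma summ_conductance x : summ (c x).
Proof. by apply: summ_fin => //; apply: total_conductance_fin hG x. Qed.

Lemma vertex_weightE x : vertex_weight x = rsum (c x).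
Proof. by rewrite /vertex_weight /total_conductance rsum_fin//; apply: summ_conductance. Qed.

Lemma vertex_weight_ge0 x : 0 <= vertex_weight x.
Proof. by rewrite vertex_weightE rsum_ge0. Qed.

Lemma conductance_le_weight x y : c x y <= vertex_weight x.
Proof. by rewrite vertex_weightE (@term_le_rsum _ _ (c x))//; apply: summ_conductance. Qed.

Lemma conductance_weight0 x y : vertex_weight x = 0 -> c x y = 0.
Proof.
by move=> x0; apply/eqP; rewrite eq_le c0 -x0 conductance_le_weight.
Qed.

(** A nonempty path from [x] would begin with an edge of positive conductance at [x]. *)
Lemma weight0_single x y : vertex_weight x = 0 -> y = x.
Proof.
move=> x0; have [s] := network_connected hG x y.
case: s => [|z s] //= /andP[]; by rewrite conductance_weight0// ltxx.
Qed.

Lemma transition0 x y : vertex_weight x = 0 -> transition c x y = (x == y)%:R.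
Proof. by move=> x0; rewrite /transition total_conductanceE x0 eqxx. Qed.

Lemma transitionE x y : vertex_weight x != 0 ->
  transition c x y = c x y / vertex_weight x.
Proof. by move=> x0; rewrite /transition total_conductanceE eqe (negbTE x0). Qed.

Lemma transition_ge0 x y : 0 <= transition c x y.
Proof.
have [/transition0->|x0] := eqVneq (vertex_weight x) 0; first exact: ler0n.
by rewrite transitionE// divr_ge0// vertex_weight_ge0.
Qed.

(** Also true at weight 0, where all conductances at [x] vanish; Green's formula thus needs no case
    distinction. *)
Lemma weight_transition x y : vertex_weight x * transition c x y = c x y.
Proof.
have [x0|x0] := eqVneq (vertex_weight x) 0.
  by rewrite x0 mul0r conductance_weight0.
by rewrite transitionE// mulrC divfK.
Qed.

Lemma transition_gt0 x y : 0 < c x y -> 0 < transition c x y.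
Proof.
move=> cxy; rewrite lt_def transition_ge0 andbT; apply/eqP => p0.
by move: cxy; rewrite -weight_transition p0 mulr0 ltxx.
Qed.

Lemma summ_transition x : summ (transition c x).
Proof.
have [x0|x0] := eqVneq (vertex_weight x) 0.
  apply: (@summ_supp1 _ _ _ x) => y yx.
  by rewrite transition0// eq_sym (negbTE yx).
apply: (@eq_summ _ _ _ (fun y => (vertex_weight x)^-1 * c x y)).
  by move=> y; rewrite transitionE// mulrC.
by apply: summZ; exact: summ_conductance.
Qed.

Lemma rsum_transition x : rsum (transition c x) = 1.
Proof.
have [x0|x0] := eqVneq (vertex_weight x) 0.
  rewrite (@rsum_supp1 _ _ _ x) ?transition0 ?eqxx// => y yx.
  by rewrite transition0// eq_sym (negbTE yx).
rewrite (@eq_rsum _ _ _ (fun y => (vertex_weight x)^-1 * c x y)); last first.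
  by move=> y; rewrite transitionE// mulrC.
rewrite rsumZ; last exact: summ_conductance.
by rewrite -vertex_weightE mulVf.
Qed.

Lemma summ_average f M x : (forall y, `|f y| <= M) ->
  summ (fun y => transition c x y * f y).
Proof.
move=> fM; apply: (@summ_le _ _ (fun y => M * transition c x y)).
  move=> y; rewrite normrM ger0_norm ?transition_ge0// mulrC.
  by apply: ler_wpM2r => //; exact: transition_ge0.
by apply: summZ; exact: summ_transition.
Qed.

Lemma eq_average f g x : f =1 g -> average f x = average g x.
Proof. by move=> fg; apply: eq_rsum => y; rewrite fg. Qed.

Lemma average_ge0 f x : (forall y, 0 <= f y) -> 0 <= average f x.
Proof. by move=> f0; apply: rsum_ge0 => y; rewrite mulr_ge0// transition_ge0. Qed.

Lemma ler_average f g M x : (forall y, `|f y| <= M) -> (forall y, `|g y| <= M) ->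
  (forall y, f y <= g y) -> average f x <= average g x.
Proof.
move=> fM gM fg; apply: ler_rsum; [exact: summ_average fM|exact: summ_average gM|].
by move=> y; apply: ler_wpM2l => //; exact: transition_ge0.
Qed.

Lemma average_cst (k : R) x : average (fun=> k) x = k.
Proof.
rewrite /average (@eq_rsum _ _ _ (fun y => k * transition c x y)).
  by rewrite rsumZ ?rsum_transition ?mulr1//; exact: summ_transition.
by move=> y; rewrite mulrC.
Qed.

Lemma averageZ (k : R) f M x : (forall y, `|f y| <= M) ->
  average (fun y => k * f y) x = k * average f x.
Proof.
move=> fM; rewrite /average -rsumZ; last exact: summ_average fM.
by apply: eq_rsum => y; rewrite mulrCA.
Qed.

Lemma averageD f g M N x : (forall y, `|f y| <= M) -> (forall y, `|g y| <= N) ->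
  average (fun y => f y + g y) x = average f x + average g x.
Proof.
move=> fM gN.
rewrite /average -rsumD; [|exact: summ_average fM|exact: summ_average gN].
by apply: eq_rsum => y; rewrite mulrDr.
Qed.

Lemma averageB f g M N x : (forall y, `|f y| <= M) -> (forall y, `|g y| <= N) ->
  average (fun y => f y - g y) x = average f x - average g x.
Proof.
move=> fM gN.
rewrite /average -rsumB; [|exact: summ_average fM|exact: summ_average gN].
by apply: eq_rsum => y; rewrite mulrBr.
Qed.

Lemma average_norm f M x : (forall y, `|f y| <= M) ->
  `|average f x| <= average (fun y => `|f y|) x.
Proof.
move=> fM; apply: (le_trans (ler_norm_rsum (summ_average _ fM))).
rewrite le_eqVlt; apply/orP; left; apply/eqP/eq_rsum => y.
by rewrite normrM ger0_norm ?transition_ge0.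
Qed.

Lemma weight_average f x M : (forall y, `|f y| <= M) ->
  vertex_weight x * average f x = rsum (fun y => c x y * f y).
Proof.
move=> fM; rewrite /average -rsumZ; last exact: summ_average fM.
by apply: eq_rsum => y; rewrite mulrA weight_transition.
Qed.

Lemma energy_summ f g : finite_energy f -> finite_energy g ->
  summ (fun p => c p.1 p.2 * (f p.1 - f p.2) * (g p.1 - g p.2)).
Proof.
move=> sf sg; apply: summ_le (summD sf sg) => p.
rewrite !normrM ger0_norm// -!mulrA -mulrDr; apply: ler_wpM2l => //.
set s := f p.1 - f p.2; set t := g p.1 - g p.2.
rewrite -[s * s]expr2 -[t * t]expr2 -[s ^+ 2]real_normK ?num_real// -[t ^+ 2]real_normK ?num_real//.
have := sqr_ge0 (`|s| - `|t|); have := mulr_ge0 (normr_ge0 s) (normr_ge0 t).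
by nra.
Qed.

Lemma energyC f g : energy f g = energy g f.
Proof. by congr (_ * _); apply: eq_rsum => p; rewrite mulrAC. Qed.

Lemma energy_ge0 f : 0 <= energy f f.
Proof.
rewrite mulr_ge0 ?invr_ge0//; apply: rsum_ge0 => p.
by rewrite -mulrA mulr_ge0// -expr2 sqr_ge0.
Qed.

Lemma finite_energyD f g : finite_energy f -> finite_energy g ->
  finite_energy (fun x => f x + g x).
Proof.
move=> sf sg; have sfg := energy_summ sf sg.
apply: (eq_summ _ (summD (summD sf sg) (summZ 2 sfg))) => p /=.
by lra.
Qed.

Lemma finite_energyZ (k : R) f : finite_energy f -> finite_energy (fun x => k * f x).
Proof.
by move=> sf; apply: (eq_summ _ (summZ (k ^+ 2) sf)) => p /=; lra.
Qed.

Lemma finite_energyB f g : finite_energy f -> finite_energy g ->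
  finite_energy (fun x => f x - g x).
Proof.
move=> sf sg; have := finite_energyD sf (finite_energyZ (-1) sg).
by apply: eq_summ => p; rewrite !mulN1r.
Qed.

Lemma energyDl f g h : finite_energy f -> finite_energy g -> finite_energy h ->
  energy (fun x => f x + g x) h = energy f h + energy g h.
Proof.
move=> sf sg sh; rewrite /energy -mulrDr -rsumD; [|exact: energy_summ..].
by congr (_ * _); apply: eq_rsum => p; lra.
Qed.

Lemma energyZl (k : R) f h : finite_energy f -> finite_energy h ->
  energy (fun x => k * f x) h = k * energy f h.
Proof.
move=> sf sh; rewrite /energy mulrCA -(rsumZ k); last exact: energy_summ.
by congr (_ * _); apply: eq_rsum => p; lra.
Qed.

Lemma energyBl f g h : finite_energy f -> finite_energy g -> finite_energy h ->
  energy (fun x => f x - g x) h = energy f h - energy g h.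
Proof.
move=> sf sg sh; rewrite /energy -mulrBr -rsumB; [|exact: energy_summ..].
by congr (_ * _); apply: eq_rsum => p; lra.
Qed.

Lemma energyZr (k : R) f h : finite_energy f -> finite_energy h ->
  energy f (fun x => k * h x) = k * energy f h.
Proof. by move=> sf sh; rewrite energyC energyZl// energyC. Qed.

Lemma energyD f g : finite_energy f -> finite_energy g ->
  energy (fun x => f x + g x) (fun x => f x + g x) =
  energy f f + 2 * energy f g + energy g g.
Proof.
move=> sf sg; have sfg := finite_energyD sf sg.
rewrite energyDl// (energyC f (fun _ => _)) (energyC g (fun _ => _)) !energyDl// (energyC g f); lra.
Qed.

Lemma energyB f g : finite_energy f -> finite_energy g ->
  energy (fun x => f x - g x) (fun x => f x - g x) =
  energy f f - 2 * energy f g + energy g g.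
Proof.
move=> sf sg; have sfg := finite_energyB sf sg.
rewrite energyBl// (energyC f (fun _ => _)) (energyC g (fun _ => _)) !energyBl// (energyC g f); lra.
Qed.

Lemma resistance_formE f g : finite_energy f -> finite_energy g ->
  resistance_form c f g = (energy f g)%:E.
Proof.
move=> sf sg; rewrite /resistance_form /energy /rsum EFinM fineK//.
rewrite fin_numB.
have := energy_summ sf sg => /[dup].
move=> /summable_funepos + /summable_funeneg.
rewrite !summableE.
under eq_esum do rewrite gee0_abs//.
by move=> ->; under eq_esum do rewrite gee0_abs//.
Qed.

(** On the diagonal the integrand is nonnegative: the negative sum is 0, and an infinite positive
    sum makes the form infinite. *)
Lemma form_domainP f : form_domain c f <-> finite_energy f.
Proof.
split => [|sf]; last by rewrite /form_domain /= resistance_formE// ltry.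
rewrite /form_domain /= /resistance_form => h.
have n0 p : 0 <= c p.1 p.2 * (f p.1 - f p.2) * (f p.1 - f p.2).
  by rewrite -mulrA mulr_ge0// -expr2 sqr_ge0.
apply: summ_fin => //.
move: h; set F := fun p : V * V => _%:E.
have -> : \esum_(p in [set: V * V]) F^\-%E p = 0%E.
  by apply: esum1 => p _; rewrite funenegE; apply/max_idPr; rewrite lee_fin oppr_le0.
have -> : \esum_(p in [set: V * V]) F^\+%E p = (\esum_(p in [set: V * V]) F p)%E.
  by apply: eq_esum => p _; rewrite funeposE; apply/max_idPl; rewrite lee_fin.
rewrite sube0; case: (esum _ _) => [r _||].
- exact: ltry.
- by rewrite mulry gtr0_sg ?mul1e// invr_gt0.
- by [].
Qed.

Lemma energy_contraction f g : finite_energy f ->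
  (forall x y, `|g x - g y| <= `|f x - f y|) ->
  finite_energy g /\ energy g g <= energy f f.
Proof.
move=> sf fg.
have le p : c p.1 p.2 * (g p.1 - g p.2) * (g p.1 - g p.2) <=
    c p.1 p.2 * (f p.1 - f p.2) * (f p.1 - f p.2).
  rewrite -!mulrA ler_wpM2l// -!expr2 -[_ ^+ 2]real_normK ?num_real//.
  by rewrite -[leRHS]real_normK ?num_real// lerXn2r ?nnegrE.
have sg : finite_energy g.
  apply: summ_le sf => p; rewrite ger0_norm//.
  by rewrite -mulrA mulr_ge0// -expr2 sqr_ge0.
by split => //; rewrite ler_wpM2l ?invr_ge0//; apply: ler_rsum.
Qed.

(** Keep only the term of the ordered pair [(x, y)]; the factor 2 undoes the [2^-1] of the
    energy. *)
Lemma energy_edge f x y : finite_energy f ->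
  c x y * (f x - f y) ^+ 2 <= 2 * energy f f.
Proof.
move=> sf; rewrite /energy mulVKf//.
have := @term_le_rsum R _ _ (x, y) _ sf; rewrite /= -mulrA -expr2; apply => p.
by rewrite -mulrA mulr_ge0// -expr2 sqr_ge0.
Qed.

Lemma energy0_cst f x y : finite_energy f -> energy f f <= 0 -> f x = f y.
Proof.
move=> sf f0; have e0 : energy f f = 0 by apply/eqP; rewrite eq_le f0 energy_ge0.
have [s] := network_connected hG x y.
elim: s x => [|z s IH] x /=; first by move=> _ ->.
move=> /andP[cxz] ps ls; rewrite -(IH z ps ls).
have := energy_edge x z sf; rewrite e0 mulr0 => le0.
have : (f x - f z) ^+ 2 <= 0 by rewrite -(pmulr_rle0 _ cxz).
by rewrite real_exprn_even_le0 ?num_real//= subr_eq0 => /eqP.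
Qed.

(** Integrability for the reversible measure. Unlike finite support, it is preserved by [average]
    when degrees are infinite. *)
Definition integrable_vertex phi : Prop := summ (fun x => vertex_weight x * phi x).

Lemma summ_weight_pair phi : integrable_vertex phi ->
  summ (fun p : V * V => c p.1 p.2 * `|phi p.1|).
Proof.
move=> sphi; have /= h x : rsum (fun y => c x y * `|phi x|) = vertex_weight x * `|phi x|.
  rewrite (@eq_rsum _ _ _ (fun y => `|phi x| * c x y)); last by move=> y; rewrite mulrC.
  by rewrite rsumZ ?vertex_weightE 1?mulrC//; exact: summ_conductance.
apply: summ_pair => /=.
- by move=> p; rewrite mulr_ge0.
- move=> x; apply: (@eq_summ _ _ _ (fun y => `|phi x| * c x y)).
    by move=> y; rewrite mulrC.
  by apply: summZ; exact: summ_conductance.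
- apply: (eq_summ h); have := summ_norm sphi; apply: eq_summ => x.
  by rewrite normrM ger0_norm// vertex_weight_ge0.
Qed.

(** By symmetry of [c] the integrand is [F] plus [F] at the swapped pair, and the sum of [F] over
    its second coordinate is the term at [x] on the right. The two equal halves absorb the
    [2^-1]. *)
Lemma green phi g M : integrable_vertex phi -> (forall x, `|g x| <= M) ->
  summ (fun p => c p.1 p.2 * (phi p.1 - phi p.2) * (g p.1 - g p.2)) /\
  summ (fun x => vertex_weight x * phi x * (g x - average g x)) /\
  energy phi g = rsum (fun x => vertex_weight x * phi x * (g x - average g x)).
Proof.
move=> sphi gM.
pose F (p : V * V) := c p.1 p.2 * phi p.1 * (g p.1 - g p.2).
have sF : summ F.
  apply: (@summ_le _ _ (fun p : V * V => (2 * M) * (c p.1 p.2 * `|phi p.1|))).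
    move=> p; rewrite !normrM (ger0_norm (c0 _ _)) mulrC.
    rewrite ler_wpM2r ?mulr_ge0//.
    by rewrite (le_trans (ler_normB _ _))// [2 * M]mulr_natl mulr2n lerD.
  by apply: summZ; exact: summ_weight_pair.
have sF' := summ_swap sF.
have E p : c p.1 p.2 * (phi p.1 - phi p.2) * (g p.1 - g p.2) = F p + F (p.2, p.1).
  by rewrite /F /= (cC p.2); lra.
have [s1 e1] := rsum_pair sF.
have E2 x : rsum (fun y => F (x, y)) = vertex_weight x * phi x * (g x - average g x).
  rewrite /F /= (@eq_rsum _ _ _ (fun y => phi x * (c x y * g x - c x y * g y))); last first.
    by move=> y; lra.
  have sg : summ (fun y => c x y * g y).
    apply: (@eq_summ _ _ _ (fun y => vertex_weight x * (transition c x y * g y))).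
      by move=> y; rewrite mulrA weight_transition.
    by apply: summZ; exact: summ_average gM.
  have sc : summ (fun y => c x y * g x).
    apply: (@eq_summ _ _ _ (fun y => g x * c x y)); first by move=> y; rewrite mulrC.
    by apply: summZ; exact: summ_conductance.
  rewrite rsumZ ?rsumB//; last exact: summB.
  rewrite -(weight_average _ gM) (@eq_rsum _ _ _ (fun y => g x * c x y)); last first.
    by move=> y; rewrite mulrC.
  rewrite rsumZ; last exact: summ_conductance.
  by rewrite -vertex_weightE; lra.
split; first by apply: (eq_summ E); apply: summD.
split; first by apply: eq_summ s1 => x; rewrite E2.
rewrite /energy (eq_rsum E) rsumD// (rsum_swap F) e1 (eq_rsum E2); lra.
Qed.

End Networks.

(** * Recurrence and the maximum principle *)

Section Clip.
Context {R : realType}.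
Implicit Types s t : R.

Definition clip s : R := Num.min (Num.max s 0) 1.

Lemma clip_ge0 s : 0 <= clip s.
Proof. by rewrite le_min ler01 le_max lexx orbT. Qed.

Lemma clip_le1 s : clip s <= 1.
Proof. by rewrite ge_min lexx orbT. Qed.

Lemma clip0 : clip 0 = 0.
Proof. by rewrite /clip maxxx min_l. Qed.

Lemma clip1 : clip 1 = 1.
Proof. by rewrite /clip max_l// minxx. Qed.

Lemma clip_cases s :
  [\/ s <= 0 /\ clip s = 0, 0 <= s <= 1 /\ clip s = s | 1 <= s /\ clip s = 1].
Proof.
rewrite /clip; have [s0|/ltW s0] := leP s 0.
  by apply: Or31; rewrite min_l.
have [s1|/ltW s1] := leP s 1; last by apply: Or33.
by apply: Or32; rewrite s0.
Qed.

Lemma clip_contraction s t : `|clip s - clip t| <= `|s - t|.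
Proof.
wlog st : s t / t <= s => [wl|].
  by have [/wl//|/ltW/wl] := leP t s; rewrite distrC [leRHS]distrC.
rewrite [leRHS]ger0_norm ?subr_ge0// ler_norml.
have [[? ->]|[/andP[? ?] ->]|[? ->]] := clip_cases s;
have [[? ->]|[/andP[? ?] ->]|[? ->]] := clip_cases t; lra.
Qed.

End Clip.

Section Recurrence.
Context {R : realType} {V : countType}.
Variable c : V -> V -> R.
Implicit Types f g : V -> R.
Hypothesis hG : electrical_network c.
Hypothesis hrec : recurrent c.

Lemma summ_finite_support (T : choiceType) (F : T -> R) (U : set T) :
  finite_set U -> (forall x, ~ U x -> F x = 0) -> summ F.
Proof.
move=> finU F0; rewrite /summ /summable.
rewrite (@eq_esum _ _ _ _ (fun y => if y \in U then `|(F y)%:E| else 0)%E); last first.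
  move=> y _ /=; case: ifPn => //; rewrite notin_setE => /F0 ->.
  by rewrite normr0.
rewrite -esum_mkcond esum_fset// fsbig_finite//=.
by rewrite sumEFin ltry.
Qed.

(** The same [e] controls the energy and the defect at [x], so the property can be carried along
    edges. *)
Definition cutoff_at (x : V) : Prop := forall e : R, 0 < e ->
  exists f, [/\ finite_energy c f, integrable_vertex c f,
    (forall y, 0 <= f y <= 1), energy c f f < e & 1 - e < f x].

Lemma recurrent_cutoff : exists x, cutoff_at x.
Proof.
case: hrec => U [r [finU _ _ cvU]]; exists r => e e0.
have [n] : exists n, (e^-1%:E < effective_resistance c [set r] (~` U n))%E.
  move/cvgeyPgt : cvU => /(_ e^-1) [N _ HN]; exists N; apply: HN => /=.
  exact: leqnn.
rewrite /effective_resistance; set S := [set _ | _ in _] => h.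
(* Resistance above [e^-1] is inverted: infimum 0 is harmless, and infimum [+oo] would mean
   resistance 0. *)
have : (ereal_inf S < e%:E)%E.
  have S0 : (0 <= ereal_inf S)%E.
    apply: le_ereal_inf_tmp => _ [f [/(form_domainP hG) sf _ _] <-].
    by rewrite resistance_formE// lee_fin energy_ge0.
  move: S0 h; case: (ereal_inf S) => [i||]//=.
    rewrite lee_fin lte_fin; rewrite le_eqVlt => /orP[/eqP <- //|i0].
    by rewrite inver gt_eqF// lte_fin ltf_pV2.
  by rewrite invey lte_fin => _; rewrite invr_lt0 ltNge ltW.
move=> /ereal_inf_lt[_ [f [/(form_domainP hG) sf fr fU] <-]].
rewrite resistance_formE// lte_fin => fe.
have [sg eg] := energy_contraction hG sf (fun x y => clip_contraction (f x) (f y)).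
exists (clip \o f); split => //.
- apply: (summ_finite_support (finU n)) => x Ux /=.
  by rewrite fU ?clip0 ?mulr0.
- by move=> y /=; rewrite clip_ge0 clip_le1.
- exact: le_lt_trans fe.
- by rewrite /= fr ?clip1// ltrBlDr ltrDl.
Qed.

Lemma cutoff_edge x y : 0 < c x y -> cutoff_at x -> cutoff_at y.
Proof.
move=> cxy cx e e0.
(* The first entry leaves a defect of at most [e / 2] at [x]; the second makes [energy_edge] bound
   the change along the edge by [e / 2]. *)
pose d := Num.min (e / 2) (c x y * (e / 2) ^+ 2 / 2).
have d0 : 0 < d by rewrite lt_min !divr_gt0//= mulr_gt0// exprn_gt0// divr_gt0.
have [f [sf lf f01 fd fx]] := cx _ d0; exists f; split => //.
  by rewrite (lt_le_trans fd)// ge_min; apply/orP; left; lra.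
have d1 : d <= e / 2 by rewrite ge_min lexx.
have d2 : d <= c x y * (e / 2) ^+ 2 / 2 by rewrite ge_min lexx orbT.
have := energy_edge hG x y sf => h.
have {}h : c x y * (f x - f y) ^+ 2 < c x y * (e / 2) ^+ 2 by lra.
move: h; rewrite ltr_pM2l// => h.
have : `|f x - f y| < e / 2.
  rewrite -(@ltr_pXn2r _ 2) ?nnegrE//; last by lra.
  by rewrite real_normK ?num_real.
by rewrite ltr_norml; lra.
Qed.

Lemma cutoff x : cutoff_at x.
Proof.
have [r cr] := recurrent_cutoff.
have [s] := network_connected hG r x.
elim: s r cr => [|z s IH] r cr /=; first by move=> _ <-.
by move=> /andP[rz] ps ls; apply: (IH z) => //; apply: cutoff_edge cr.
Qed.

(* Picone: the increment of [f ^+ 2 / g] times that of [g] is at most the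
   squared increment of [f]. *)
Lemma superharmonic_energy f g (M : R) x :
  finite_energy c f -> integrable_vertex c f -> (forall y, 0 <= f y <= 1) ->
  (forall y, 1 <= g y <= M) -> (forall y, average c g y <= g y) ->
  vertex_weight c x * (f x ^+ 2 / g x) * (g x - average c g x) <= energy c f f.
Proof.
move=> sf lf f01 gM Pg.
pose phi y := f y ^+ 2 / g y.
have g0 y : 0 < g y by have /andP[h _] := gM y; apply: lt_le_trans h.
have phi0 y : 0 <= phi y by rewrite /phi divr_ge0 ?sqr_ge0// ltW.
(* Since [f y <= 1 <= g y]; this is how [phi] inherits integrability from the cutoff. *)
have phif y : phi y <= f y.
  rewrite /phi ler_pdivrMr//; have := f01 y; have := gM y; nra.
have lphi : integrable_vertex c phi.
  apply: summ_le lf => y; have w0 := vertex_weight_ge0 hG y.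
  by rewrite (ger0_norm (mulr_ge0 w0 (phi0 y))) ler_wpM2l.
have gM' y : `|g y| <= M by rewrite ger0_norm ?(ltW (g0 y))//; case/andP: (gM y).
have [s1 [s2 e]] := green hG lphi gM'.
(* Green's formula writes this energy as a sum of nonnegative terms, of which only the one at [x] is
   kept. *)
apply: (@le_trans _ _ (energy c phi g)).
  rewrite e; apply: (@term_le_rsum _ _
    (fun y => vertex_weight c y * phi y * (g y - average c g y))) => // y.
  have w0 := vertex_weight_ge0 hG y.
  by rewrite mulr_ge0 ?subr_ge0// (mulr_ge0 w0 (phi0 y)).
rewrite ler_wpM2l ?invr_ge0//; apply: ler_rsum => // -[y z] /=.
rewrite -!mulrA ler_wpM2l ?(conductance_ge0 hG)//.
rewrite /phi; have gy := g0 y; have gz := g0 z.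
have -> : (f y ^+ 2 / g y - f z ^+ 2 / g z) * (g y - g z) =
  (f y - f z) * (f y - f z) - (f y * g z - f z * g y) ^+ 2 / (g y * g z).
  by field; rewrite ?gt_eqF.
by rewrite lerBlDr lerDl divr_ge0 ?sqr_ge0// mulr_ge0 ?ltW//.
Qed.

Lemma bounded_superharmonic g (M : R) x :
  (forall y, 1 <= g y <= M) -> (forall y, average c g y <= g y) ->
  vertex_weight c x * (g x - average c g x) <= 0.
Proof.
move=> gM Pg; set K := _ * _.
have KE : K = vertex_weight c x * (g x - average c g x) by [].
have K0 : 0 <= K by rewrite mulr_ge0 ?subr_ge0// vertex_weight_ge0.
clearbody K.
rewrite leNgt; apply/negP => Kp.
have g1 : 1 <= g x by have /andP[] := gM x.
have gM1 : g x <= M by have /andP[] := gM x.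
(* With [e <= 1 / 2] the square of [f x] is at least 1/4, so the energy of [f] is at least
   [K / (4 * M)], twice the second entry: a contradiction. *)
pose e := Num.min (1 / 2) (K / (8 * M)).
have M0 : 0 < M by lra.
have e0 : 0 < e by rewrite lt_min divr_gt0//= divr_gt0// mulr_gt0.
have [f [sf lf f01 fe fx]] := cutoff x e0.
have e1 : e <= 1 / 2 by rewrite ge_min lexx.
have e2 : e <= K / (8 * M) by rewrite ge_min lexx orbT.
have := superharmonic_energy x sf lf f01 gM Pg.
rewrite (_ : _ * _ = K * f x ^+ 2 / g x); last by rewrite KE; lra.
have h1 : K * f x ^+ 2 / g x >= K * (1 / 4) / M.
  apply: ler_pM; first by rewrite mulr_ge0.
  - by rewrite invr_ge0 ltW.
  - by rewrite ler_wpM2l//; nra.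
  - by rewrite lef_pV2 ?posrE//; lra.
have h2 : K * (1 / 4) / M = 2 * (K / (8 * M)) by field; rewrite gt_eqF.
have : 0 < K / (8 * M) by rewrite divr_gt0// mulr_gt0.
by move: h1 h2 fe e2; lra.
Qed.

(* |g| is subharmonic, so M + 1 - |g| is superharmonic and bounded: by
   recurrence |g| is harmonic, and it vanishes somewhere. *)
Lemma bounded_harmonic_eq0 (D : set V) g (M : R) :
  D !=set0 -> (forall x, `|g x| <= M) -> (forall x, D x -> g x = 0) ->
  (forall x, ~ D x -> g x = average c g x) -> forall x, g x = 0.
Proof.
move=> [r Dr] gM gD gh.
pose a x := `|g x|.
have aM x : `|a x| <= M by rewrite normr_id.
have sub x : a x <= average c a x.
  have [Dx|Dx] := pselect (D x).
    by rewrite /a gD// normr0 average_ge0.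
  by rewrite /a {1}gh//; apply: average_norm.
(* The extra 1 gives [1 <= G], as [bounded_superharmonic] requires. *)
pose G x := (M + 1) - a x.
have M0 : 0 <= M by apply: le_trans (gM r).
have AG x : average c G x = (M + 1) - average c a x.
  rewrite /G (@averageB _ _ _ hG (fun=> M + 1) a (M + 1) M)//.
    by rewrite average_cst.
  by move=> _; rewrite ger0_norm//; lra.
have harm x : vertex_weight c x * (average c a x - a x) = 0.
  apply/eqP; rewrite eq_le mulr_ge0 ?vertex_weight_ge0 ?subr_ge0// andbT.
  have := @bounded_superharmonic G (M + 1) x _ _.
  rewrite AG /G (_ : _ - _ - _ = average c a x - a x); last by lra.
  apply => y; first by have := gM y; have := normr_ge0 (g y); rewrite /a; lra.
  by rewrite AG; have := sub y; lra.
(* At a zero of [g], harmonicity of [a] makes a sum of nonnegative terms over the neighbours vanish,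
   hence every term. *)
have step x y : 0 < c x y -> g x = 0 -> g y = 0.
  move=> cxy gx; have := harm x; rewrite {2}/a gx normr0 subr0 => /eqP.
  rewrite (weight_average hG _ aM) => /eqP h.
  have : c x y * a y <= 0.
    rewrite -h; apply: (@term_le_rsum _ _ (fun y => c x y * a y)) => [z|].
      exact: (mulr_ge0 (conductance_ge0 hG x z) (normr_ge0 (g z))).
    apply: (@eq_summ _ _ _ (fun y => vertex_weight c x * (transition c x y * a y))).
      by move=> z; rewrite mulrA weight_transition.
    by apply: summZ; apply: summ_average aM.
  by rewrite pmulr_rle0// /a normr_le0 => /eqP.
move=> x; have [s] := network_connected hG r x.
have := gD _ Dr; elim: s r {Dr} => [|z s IH] r gr /=; first by move=> _ <-.
by move=> /andP[rz] ps ls; apply: (IH z) => //; apply: step gr.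
Qed.

End Recurrence.

(** * Hitting probabilities as energy minimizers *)

Section Hitting.
Context {R : realType} {V : countType}.
Variable c : V -> V -> R.
Implicit Types (f g v phi : V -> R) (D : set V).

(* Probability that the chain started at [z] visits [D] within [n] steps, and for
   the first time at [x]. *)
Fixpoint hit_within D (x : V) (n : nat) (z : V) : R :=
  if n is n'.+1 then
    if z \in D then (z == x)%:R else average c (hit_within D x n') z
  else (z == x)%:R.

Definition hit D (x z : V) : R := limn (fun n => hit_within D x n z).

Hypothesis hG : electrical_network c.

(** Monotone convergence: monotonicity bounds the limit of the averages from above, [fatou_rsum]
    from below. *)
Lemma average_cvg (fn : nat -> V -> R) f x :
  (forall n y, 0 <= fn n y <= 1) -> (forall n y, fn n y <= fn n.+1 y) ->
  (forall y, fn n y @[n --> \oo] --> f y) ->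
  average c (fn n) x @[n --> \oo] --> average c f x.
Proof.
move=> f01 fnd fnf.
have fn1 n y : `|fn n y| <= 1 by have /andP[? ?] := f01 n y; rewrite ger0_norm.
have f0 y : 0 <= f y by apply: (cvgr_to_ge (fnf y)); apply: nearW => n; case/andP: (f01 n y).
have f1 y : `|f y| <= 1.
  by rewrite ger0_norm//; apply: (cvgr_to_le (fnf y)); apply: nearW => n; case/andP: (f01 n y).
have nd y : nondecreasing_seq (fun n => fn n y) by apply/nondecreasing_seqP => n.
have fnlef n y : fn n y <= f y.
  have fy : limn (fun n => fn n y) = f y by apply/cvg_lim.
  by rewrite -fy; apply: nondecreasing_cvgn_le => //; apply/cvg_ex; exists (f y).
have und : nondecreasing_seq (fun n => average c (fn n) x).
  by apply/nondecreasing_seqP => n; apply: ler_average.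
have ub n : average c (fn n) x <= average c f x by apply: ler_average.
have ucv : cvgn (fun n => average c (fn n) x).
  apply: nondecreasing_is_cvgn => //; exists (average c f x) => _ [n _ <-].
  exact: ub.
rewrite (_ : average c f x = limn (fun n => average c (fn n) x)); first exact: ucv.
apply/eqP; rewrite eq_le; apply/andP; split; last first.
  by apply: limr_le => //; apply: nearW.
have [] // := @fatou_rsum R V (fun n y => transition c x y * fn n y)
  (fun y => transition c x y * f y) (limn (fun n => average c (fn n) x)).
- by move=> n y; rewrite mulr_ge0 ?transition_ge0//; case/andP: (f01 n y).
- by move=> n; apply: summ_average (fn1 n).
- by move=> n; apply: (nondecreasing_cvgn_le und).
- by move=> y; apply: cvgM; [exact: cvg_cst|exact: fnf].
Qed.

(** Reversibility: the sum of [c x y * f y] over pairs may be taken in either order. *)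
Lemma integrable_average f M : (forall y, 0 <= f y) -> (forall y, `|f y| <= M) ->
  integrable_vertex c f -> integrable_vertex c (average c f).
Proof.
move=> f0 fM lf.
have [s _] := rsum_pair (summ_swap (summ_weight_pair hG lf)).
apply: eq_summ s => x; rewrite (weight_average hG _ fM).
by apply: eq_rsum => y /=; rewrite (conductance_sym hG) ger0_norm.
Qed.

Lemma integrable_point x : integrable_vertex c (fun z => (z == x)%:R).
Proof. by apply: (@summ_supp1 _ _ _ x) => y /negbTE ->; rewrite mulr0. Qed.

Lemma finite_energy_integrable f M : (forall y, `|f y| <= M) ->
  integrable_vertex c f -> finite_energy c f.
Proof. by move=> fM lf; have [] := green hG lf fM. Qed.

(** * First visit at one target point, and its energy *)

Section Target.
Variables (D : set V) (x : V).
Hypothesis Dx : D x.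
Notation hw := (hit_within D x).
Notation ht := (hit D x).

Lemma hit_within_in n z : D z -> hw n z = (z == x)%:R.
Proof. by case: n => //= n Dz; rewrite mem_set. Qed.

Lemma hit_within_out n z : ~ D z -> hw n.+1 z = average c (hw n) z.
Proof. by move=> Dz; rewrite /= memNset. Qed.

Lemma hit_within_01 n z : 0 <= hw n z <= 1.
Proof.
elim: n z => [|n IH] z /=; first by case: eqP => _; rewrite ?lexx ?ler01.
case: ifP => _; first by case: eqP => _; rewrite ?lexx ?ler01.
rewrite (average_ge0 hG)/=; last by move=> y; case/andP: (IH y).
rewrite -[leRHS](average_cst hG 1 z); apply: (@ler_average _ _ _ hG _ _ 1).
- by move=> y; have /andP[? ?] := IH y; rewrite ger0_norm.
- by move=> y; rewrite normr1.
- by move=> y; case/andP: (IH y).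
Qed.

Lemma hit_within_norm n z : `|hw n z| <= 1.
Proof. by have /andP[? ?] := hit_within_01 n z; rewrite ger0_norm. Qed.

Lemma hit_withinS n z : hw n z <= hw n.+1 z.
Proof.
elim: n z => [|n IH] z.
  have [zD|zD] := pselect (D z); first by rewrite !hit_within_in.
  have [zx|zx] := eqVneq z x; first by case: zD; rewrite zx.
  rewrite hit_within_out// [leLHS]/= (negbTE zx).
  by apply: average_ge0 => // y; case/andP: (hit_within_01 0 y).
have [zD|zD] := pselect (D z); first by rewrite !hit_within_in.
by rewrite !hit_within_out//; apply: ler_average => // y; exact: hit_within_norm.
Qed.

Lemma hit_within_nd z : nondecreasing_seq (fun n => hw n z).
Proof. by apply/nondecreasing_seqP => n; exact: hit_withinS. Qed.

Lemma hit_within_cvg z : hw n z @[n --> \oo] --> ht z.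
Proof.
apply: nondecreasing_is_cvgn; first exact: hit_within_nd.
by exists 1 => _ [n _ <-]; case/andP: (hit_within_01 n z).
Qed.

Lemma hit_ge0 z : 0 <= ht z.
Proof.
apply: (cvgr_to_ge (@hit_within_cvg z)); apply: nearW => n.
by case/andP: (hit_within_01 n z).
Qed.

Lemma hit_le1 z : ht z <= 1.
Proof.
apply: (cvgr_to_le (@hit_within_cvg z)); apply: nearW => n.
by case/andP: (hit_within_01 n z).
Qed.

Lemma hit_norm z : `|ht z| <= 1.
Proof. by rewrite ger0_norm ?hit_ge0 ?hit_le1. Qed.

Lemma hit_in z : D z -> ht z = (z == x)%:R.
Proof.
move=> Dz; apply/cvg_lim => //.
by under eq_fun do rewrite hit_within_in//; exact: cvg_cst.
Qed.

Lemma average_hit_within_cvg z :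
  average c (hw n) z @[n --> \oo] --> average c ht z.
Proof.
by apply: average_cvg;
  [exact: hit_within_01|exact: hit_withinS|exact: hit_within_cvg].
Qed.

Lemma hit_out z : ~ D z -> ht z = average c ht z.
Proof.
move=> Dz; have h : hw n.+1 z @[n --> \oo] --> ht z.
  by have := @hit_within_cvg z; rewrite -cvg_shiftS.
apply: (cvg_unique _ h) => //.
rewrite (_ : (fun n => hw n.+1 z) = (fun n => average c (hw n) z)).
  exact: average_hit_within_cvg.
by apply/funext => n; rewrite hit_within_out.
Qed.

Lemma hit_self : ht x = 1.
Proof. by rewrite hit_in// eqxx. Qed.

(** Each iterate is at most the point mass at [x] plus the average of the previous iterate. *)
Lemma integrable_hit_within n : integrable_vertex c (hw n).
Proof.
elim: n => [|n IH]; first exact: integrable_point.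
have hw0 y : 0 <= hw n y by case/andP: (hit_within_01 n y).
have la := integrable_average hw0 (hit_within_norm n) IH.
apply: summ_le (summD (integrable_point x) la) => z.
have w0 := vertex_weight_ge0 hG z; have a0 := average_ge0 hG z hw0.
rewrite -mulrDr normrM (ger0_norm w0) ler_wpM2l//.
have [zD|zD] := pselect (D z).
  by rewrite hit_within_in// ger0_norm// lerDl.
by rewrite hit_within_out// ger0_norm// lerDr.
Qed.

(** In Green's formula with both arguments [hw n], the term at [x] is the bound, the other points of
    [D] contribute 0, and off [D] the terms are nonpositive because [hw n <= hw n.+1], which is the
    average there. *)
Lemma hit_within_energy n : finite_energy c (hw n) /\
  energy c (hw n) (hw n) <= vertex_weight c x * (1 - average c (hw n) x).
Proof.
have [s1 [s2 ->]] := green hG (integrable_hit_within n) (hit_within_norm n).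
split => //; set K := vertex_weight c x * _.
have sK y : y != x -> (y == x)%:R * K = 0 by move=> /negbTE ->; rewrite mul0r.
rewrite -[K]mul1r (_ : 1 = (x == x)%:R); last by rewrite eqxx.
rewrite -(rsum_supp1 sK); apply: ler_rsum => //; first exact: summ_supp1 sK.
move=> z; have [->|zx] := eqVneq z x.
  by rewrite hit_within_in// eqxx mulr1 mul1r.
rewrite mul0r; have w0 := vertex_weight_ge0 hG z.
have [zD|zD] := pselect (D z).
  by rewrite hit_within_in// (negbTE zx) mulr0 mul0r.
apply: mulr_ge0_le0; first by rewrite mulr_ge0//; case/andP: (hit_within_01 n z).
by rewrite subr_le0 -hit_within_out// hit_withinS.
Qed.

Lemma hit_energy_le : finite_energy c ht /\
  energy c ht ht <= vertex_weight c x * (1 - average c ht x).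
Proof.
(* Fatou needs a bound independent of [n]: the average is frozen at [m] and the sequence started
   there; [m] tends to infinity afterwards. *)
have key m : finite_energy c ht /\
    energy c ht ht <= vertex_weight c x * (1 - average c (hw m) x).
  have [||||s e] := @fatou_rsum R (V * V)%type
    (fun n p => c p.1 p.2 * (hw (n + m) p.1 - hw (n + m) p.2) * (hw (n + m) p.1 - hw (n + m) p.2))
    (fun p => c p.1 p.2 * (ht p.1 - ht p.2) * (ht p.1 - ht p.2))
    (2 * (vertex_weight c x * (1 - average c (hw m) x))).
  - move=> n p; rewrite -mulrA mulr_ge0 ?(conductance_ge0 hG)//.
    by rewrite -expr2 sqr_ge0.
  - by move=> n; have [] := hit_within_energy (n + m).
  - move=> n; have [_] := hit_within_energy (n + m).
    rewrite /energy mulrC ler_pdivrMr// mulrC => h; apply: (le_trans h).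
    rewrite ler_wpM2l// ler_wpM2l ?vertex_weight_ge0// lerB//.
    apply: (@ler_average _ _ _ hG _ _ 1) => y; rewrite ?hit_within_norm//.
    by apply: hit_within_nd; exact: leq_addl.
  - move=> p; have h y : hw (n + m) y @[n --> \oo] --> ht y.
      by have := @hit_within_cvg y; rewrite -(cvg_shiftn m).
    by apply: cvgM; [apply: cvgM; [exact: cvg_cst|exact: cvgB]|exact: cvgB].
  split => //; rewrite /energy mulrC ler_pdivrMr// mulrC.
  exact: e.
split; first by have [] := key 0%N.
have cv : vertex_weight c x * (1 - average c (hw m) x) @[m --> \oo] -->
    vertex_weight c x * (1 - average c ht x).
  by apply: cvgM; [exact: cvg_cst|apply: cvgB; [exact: cvg_cst|exact: average_hit_within_cvg]].
by apply: (cvgr_to_ge cv); apply: nearW => m; have [] := key m.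
Qed.

Lemma finite_energy_hit : finite_energy c ht.
Proof. by have [] := hit_energy_le. Qed.

Hypothesis hrec : recurrent c.

(* Test [v] against [v * f] with [f] a cutoff: [energy ht (v * f)] is computed by
   Green's formula and [energy (v * f) (v * f)] is close to [energy v v]. *)
Lemma energy_ge_flux v : finite_energy c v -> (forall z, 0 <= v z <= 1) ->
  (forall z, D z -> v z = (z == x)%:R) ->
  vertex_weight c x * (1 - average c ht x) <= energy c v v.
Proof.
move=> sv v01 vD; set L := vertex_weight c x * _.
have [sh eh] := hit_energy_le; rewrite -/L in eh.
have L0 : 0 <= L by apply: le_trans eh; exact: energy_ge0.
have E0 := energy_ge0 hG v.
(* The coefficient of [d] collects the errors below: the energy of [v] from [h2],
   [d ^+ 2 + d <= 2 * d] from [h3], and [2 * d ^+ 2 * L <= 2 * d * L] from [h4]. *)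
suff key d : 0 < d -> d <= 1 -> L <= energy c v v + d * (energy c v v + 2 + 2 * L).
  apply/ler_addgt0Pr => e e0.
  set M := energy c v v + 2 + 2 * L; have M0 : 0 < M by rewrite /M; lra.
  pose d := Num.min 1 (e / M).
  have d0 : 0 < d by rewrite lt_min ltr01 divr_gt0.
  apply: (le_trans (key d d0 _)); first by rewrite ge_min lexx.
  by rewrite lerD2l -ler_pdivlMr// ge_min lexx orbT.
move=> d0 d1.
(* The energy is below [d ^+ 2] because [h2] multiplies it by [1 + d^-1]. *)
have [f [sf lf f01 fe fx]] := cutoff hG hrec x (exprn_gt0 2 d0).
pose w z := v z * f z.
have w01 z : 0 <= w z <= 1.
  have /andP[? ?] := v01 z; have /andP[? ?] := f01 z; rewrite /w; nra.
have w1 z : `|w z| <= 1 by have /andP[? ?] := w01 z; rewrite ger0_norm.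
have lw : integrable_vertex c w.
  apply: summ_le lf => z; have w0 := vertex_weight_ge0 hG z.
  rewrite normrM (ger0_norm w0) ler_wpM2l//.
  by have /andP[? ?] := v01 z; have /andP[? ?] := f01 z; rewrite /w ger0_norm ?mulr_ge0// ler_piMl.
have sw := finite_energy_integrable w1 lw.
(* Only the term at [x] survives: [w] vanishes at the other points of [D], and [ht] is harmonic off
   [D]. *)
have ehw : energy c ht w = f x * L.
  have [_ [_]] := green hG lw hit_norm; rewrite energyC => ->.
  rewrite (@rsum_supp1 _ _ _ x).
    by rewrite hit_self /w vD// eqxx mul1r /L; lra.
  move=> z zx; have [zD|zD] := pselect (D z).
    by rewrite /w vD// (negbTE zx) mul0r mulr0 mul0r.
  by rewrite -hit_out// subrr mulr0.
have h1 : 2 * (f x * L) <= L + energy c w w.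
  have := energy_ge0 hG (fun z => w z - ht z).
  by rewrite energyB// [energy c w ht]energyC ehw; lra.
(* Discrete product rule for [w], followed by Young's inequality with weights [1 + d] and
   [1 + d^-1]. *)
have h2 : energy c w w <= (1 + d) * energy c v v + (1 + d^-1) * energy c f f.
  rewrite /energy !(mulrCA _ 2^-1) -mulrDr ler_wpM2l ?invr_ge0//.
  rewrite -!rsumZ// -rsumD; [|exact: summZ|exact: summZ].
  apply: ler_rsum => //; first by apply: summD; apply: summZ.
  move=> -[y z]; rewrite /=.
  rewrite -!(mulrA (c y z)) !(mulrCA _ (c y z)) -mulrDr.
  rewrite ler_wpM2l ?(conductance_ge0 hG)// -!expr2.
  have -> : w y - w z = f y * (v y - v z) + v z * (f y - f z) by rewrite /w; lra.
  set s := v y - v z; set t := f y - f z.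
  have /andP[fy0 fy1] := f01 y; have /andP[vz0 vz1] := v01 z.
  have fs : (f y * s) ^+ 2 <= s ^+ 2.
    by rewrite exprMn ler_piMl ?sqr_ge0// expr_le1.
  have vt : (v z * t) ^+ 2 <= t ^+ 2.
    by rewrite exprMn ler_piMl ?sqr_ge0// expr_le1.
  have : (f y * s + v z * t) ^+ 2 <=
      (1 + d) * (f y * s) ^+ 2 + (1 + d^-1) * (v z * t) ^+ 2.
    set a := f y * s; set b := v z * t.
    have -> : (1 + d) * a ^+ 2 + (1 + d^-1) * b ^+ 2 =
        (a + b) ^+ 2 + (d * a - b) ^+ 2 / d by field; rewrite gt_eqF.
    by rewrite lerDl divr_ge0 ?sqr_ge0// ltW.
  move/le_trans; apply; by apply: lerD; rewrite ler_wpM2l// addr_ge0// ?invr_ge0 ltW.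
have h3 : (1 + d^-1) * energy c f f <= d ^+ 2 + d.
  rewrite (_ : d ^+ 2 + d = (1 + d^-1) * d ^+ 2); last by field; rewrite gt_eqF.
  by rewrite ler_wpM2l// ?(ltW fe)// addr_ge0// invr_ge0 ltW.
have h4 : (1 - d ^+ 2) * L <= f x * L by rewrite ler_wpM2r// ltW.
have h5 : d ^+ 2 * L <= d * L by rewrite ler_wpM2r// expr2 ger_pMl.
have h6 : d ^+ 2 <= d by rewrite expr2 ger_pMl.
by nra.
Qed.

Lemma energy_hit : energy c ht ht = vertex_weight c x * (1 - average c ht x).
Proof.
apply/eqP; rewrite eq_le; have [sh ->] /= := hit_energy_le.
apply: energy_ge_flux => //; last exact: hit_in.
by move=> z; rewrite hit_ge0 hit_le1.
Qed.

(** Clipping to [0,1] does not increase the energy and keeps the boundary values 0 and 1. *)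
Lemma hit_energy_min v : finite_energy c v ->
  (forall z, D z -> v z = (z == x)%:R) -> energy c ht ht <= energy c v v.
Proof.
move=> sv vD.
have [sc ec] := energy_contraction hG sv (fun y z => clip_contraction (v y) (v z)).
rewrite energy_hit (le_trans _ ec)//; apply: energy_ge_flux => //.
  by move=> z; rewrite clip_ge0 clip_le1.
by move=> z /vD ->; case: eqP; rewrite ?clip0 ?clip1.
Qed.

Lemma energy_hit_orthogonal phi : finite_energy c phi ->
  (forall z, D z -> phi z = 0) -> energy c ht phi = 0.
Proof.
move=> sphi phiD; have sh := finite_energy_hit.
have key t : 0 <= 2 * (t * energy c ht phi) + t ^+ 2 * energy c phi phi.
  have st := finite_energyZ t sphi.
  have := @hit_energy_min (fun z => ht z + t * phi z) (finite_energyD hG sh st).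
  move=> h; have {h} : energy c ht ht <=
      energy c (fun z => ht z + t * phi z) (fun z => ht z + t * phi z).
    by apply: h => z Dz; rewrite phiD// mulr0 addr0 hit_in.
  rewrite energyD// energyZr// energyZl// energyZr//.
  lra.
apply/eqP/negP => /negP n0.
have E0 := energy_ge0 hG phi.
set a := energy c ht phi in key n0; set b := energy c phi phi in key E0.
(* Nearly the minimizer [- a / b] of the quadratic; the 1 covers the case [b = 0]. *)
have := key (- a / (b + 1)); have b1 : 0 < b + 1 by lra.
have -> : 2 * (- a / (b + 1) * a) + (- a / (b + 1)) ^+ 2 * b =
  - (a ^+ 2 * (b + 2) / (b + 1) ^+ 2) by field; rewrite gt_eqF.
rewrite oppr_ge0 leNgt => /negP; apply.
by rewrite divr_gt0 ?exprn_gt0// mulr_gt0 ?exprn_even_gt0//; lra.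
Qed.

(** By orthogonality the energy of [v - ht] is the difference of the two energies, hence at most 0;
    so [v - ht] is constant, and it vanishes at [x]. *)
Lemma hit_energy_unique v z : finite_energy c v ->
  (forall y, D y -> v y = (y == x)%:R) -> energy c v v <= energy c ht ht ->
  v z = ht z.
Proof.
move=> sv vD ev; have sh := finite_energy_hit.
have sd := finite_energyB hG sv sh.
have o : energy c ht (fun y => v y - ht y) = 0.
  by apply: energy_hit_orthogonal => // y Dy; rewrite vD// hit_in// subrr.
have e0 : energy c (fun y => v y - ht y) (fun y => v y - ht y) <= 0.
  move: o; rewrite energyC energyBl// => o.
  by rewrite energyB//; lra.
have := energy0_cst hG z x sd e0.
by rewrite hit_self (vD x Dx) eqxx subrr => /eqP; rewrite subr_eq0 => /eqP.
Qed.

End Target.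

Hypothesis hrec : recurrent c.

(** The point mass [dy] agrees with [hit D y] on [D], so both pair equally with [hit D x]; with the
    integrable [dy], Green's formula has a single term. *)
Lemma energy_hit_hit D x y : D x -> D y -> x != y ->
  energy c (hit D x) (hit D y) = - (vertex_weight c y * average c (hit D x) y).
Proof.
move=> Dx Dy xy; pose dy z : R := (z == y)%:R.
have sx := finite_energy_hit Dx; have sy := finite_energy_hit Dy.
have ly : integrable_vertex c dy by exact: integrable_point.
have dy1 z : `|dy z| <= 1 by rewrite /dy; case: eqP; rewrite ?normr1 ?normr0.
have sd := finite_energy_integrable dy1 ly.
have o : energy c (hit D x) (fun z => hit D y z - dy z) = 0.
  apply: energy_hit_orthogonal => //; first exact: finite_energyB.
  by move=> z Dz; rewrite hit_in// subrr.
have := o; rewrite energyC energyBl// => /eqP; rewrite subr_eq0 => /eqP.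
rewrite energyC => ->.
have [_ [_ ->]] := green hG ly (hit_norm Dx).
rewrite (@rsum_supp1 _ _ _ y); last by move=> z /negbTE zy; rewrite /dy zy mulr0 mul0r.
by rewrite /dy eqxx (hit_in _ Dy) eq_sym (negbTE xy) mulr1 sub0r mulrN.
Qed.

End Hitting.

(** * The trace network *)

Section TraceNetwork.
Context {R : realType} {V : countType}.
Variable c : V -> V -> R.
Hypothesis hG : electrical_network c.

Lemma rsum_average (T : choiceType) (h : T -> V -> R) z :
  (forall x w, 0 <= h x w) -> (forall w, summ (h ^~ w)) ->
  (forall w, rsum (h ^~ w) <= 1) ->
  summ (fun x => average c (h x) z) /\
  rsum (fun x => average c (h x) z) = average c (fun w => rsum (h ^~ w)) z.
Proof.
move=> h0 sh h1; have p0 w : 0 <= transition c z w by exact: transition_ge0.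
have E w : rsum (fun x => transition c z w * h x w) = transition c z w * rsum (h ^~ w).
  by rewrite rsumZ.
have sF : summ (fun q : V * T => transition c z q.1 * h q.2 q.1).
  apply: summ_pair => [q|w|] /=; first by rewrite mulr_ge0.
    exact: summZ.
  apply: (eq_summ E); apply: summ_le (summ_transition hG z) => w.
  have r0 : 0 <= rsum (h ^~ w) by exact: rsum_ge0.
  by rewrite ger0_norm ?mulr_ge0// ler_piMr.
have [s _] := rsum_pair (summ_swap sF).
split; first exact: s.
rewrite /average (@rsum_exchange _ _ _ (fun x w => transition c z w * h x w)).
  exact: eq_rsum.
exact: (summ_swap sF).
Qed.

Variable B : set V.
Hypothesis hrec : recurrent c.

Let Bv (x : B) : B (val x). Proof. exact: set_valP. Qed.

Lemma indicator_at_point z : summ (fun x : B => (z == val x)%:R : R) /\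
  rsum (fun x : B => (z == val x)%:R : R) = \1_B z.
Proof.
rewrite indicE; have [zB|zB] := boolP (z \in B).
  have h (x : B) : x != SigSub zB -> (z == val x)%:R = 0 :> R.
    by move=> /eqP xz; case: eqP => // zx; case: xz; apply: val_inj.
  split; first exact: summ_supp1 h.
  by rewrite (rsum_supp1 h) /= eqxx.
have h (x : B) : (z == val x)%:R = 0 :> R.
  by case: eqP => // zx; move: zB; rewrite zx; case/negP; apply: mem_set.
split; first exact: eq_summ h (summ0).
by rewrite (eq_rsum h) rsum0.
Qed.

Lemma rsum_hit_within n z : summ (fun x : B => hit_within c B (val x) n z) /\
  rsum (fun x : B => hit_within c B (val x) n z) <= 1.
Proof.
have pt y : summ (fun x : B => (y == val x)%:R : R) /\
    rsum (fun x : B => (y == val x)%:R : R) <= 1.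
  have [s ->] := indicator_at_point y; split => //.
elim: n z => [|n IH] z //=; have [zB|zB] := boolP (z \in B) => //.
have h0 (x : B) w : 0 <= hit_within c B (val x) n w.
  by case/andP: (hit_within_01 hG B (val x) n w).
have [s ->] := rsum_average z h0 (fun w => proj1 (IH w)) (fun w => proj2 (IH w)).
split => //; rewrite -[leRHS](average_cst hG 1 z).
apply: (@ler_average _ _ _ hG _ _ 1) => w; rewrite ?normr1//; last by case: (IH w).
by rewrite ger0_norm; [case: (IH w)|exact: rsum_ge0].
Qed.

Lemma rsum_hit_le1 z : summ (fun x : B => hit c B (val x) z) /\
  rsum (fun x : B => hit c B (val x) z) <= 1.
Proof.
apply: (@fatou_rsum _ _ (fun n (x : B) => hit_within c B (val x) n z)).
- by move=> n x; case/andP: (hit_within_01 hG B (val x) n z).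
- by move=> n; have [] := rsum_hit_within n z.
- by move=> n; have [] := rsum_hit_within n z.
- by move=> x; exact: hit_within_cvg.
Qed.

Let h0 (x : B) z : 0 <= hit c B (val x) z. Proof. exact: hit_ge0. Qed.

Let sh (x : B) : finite_energy c (hit c B (val x)).
Proof. exact: finite_energy_hit. Qed.

Lemma rsum_hit : B !=set0 -> forall z, rsum (fun x : B => hit c B (val x) z) = 1.
Proof.
move=> B0; pose A z := rsum (fun x : B => hit c B (val x) z).
have A0 z : 0 <= A z by exact: rsum_ge0.
have A1 z : A z <= 1 by have [] := rsum_hit_le1 z.
have An z : `|A z| <= 1 by rewrite ger0_norm.
have g1 z : `|1 - A z| <= 1 by rewrite ger0_norm ?subr_ge0// lerBlDr lerDl.
(* The function [1 - A] is the probability of never visiting [B]. *)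
have := @bounded_harmonic_eq0 _ _ _ hG hrec B (fun z => 1 - A z) 1 B0 g1 => h z.
apply/esym/eqP; rewrite -subr_eq0; apply/eqP/h => y yB.
  rewrite /A (@eq_rsum _ _ _ (fun x : B => (y == val x)%:R)); last first.
    by move=> x; rewrite hit_in.
  by have [_ ->] := indicator_at_point y; rewrite indicE mem_set// subrr.
rewrite (@averageB _ _ _ hG (fun=> 1) A 1 1)// ?average_cst//; last by move=> _; rewrite normr1.
congr (1 - _); have [_ <-] := rsum_average y h0
  (fun w => proj1 (rsum_hit_le1 w)) (fun w => proj2 (rsum_hit_le1 w)).
by apply: eq_rsum => x; exact: hit_out.
Qed.

Lemma rsum_average_hit : B !=set0 -> forall z,
  summ (fun x : B => average c (hit c B (val x)) z) /\
  rsum (fun x : B => average c (hit c B (val x)) z) = 1.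
Proof.
move=> B0 z.
have [s ->] := rsum_average z h0
  (fun w => proj1 (rsum_hit_le1 w)) (fun w => proj2 (rsum_hit_le1 w)).
by split => //; rewrite (eq_average _ _ (rsum_hit B0)) average_cst.
Qed.

Lemma energy_extension_hit (x : B) :
  energy_extension c (\1_[set x] : B -> R) = hit c B (val x).
Proof.
have bd u : (forall y : B, u (val y) = (\1_[set x] : B -> R) y) <->
    (forall z, B z -> u z = (z == val x)%:R).
  split => [h z /mem_set zB|h y].
    rewrite -[z]/(val (SigSub zB : B)) h indicE; congr (nat_of_bool _)%:R.
    by apply/idP/eqP; [rewrite inE => ->|move=> /val_inj ->; rewrite inE].
  rewrite h// indicE; congr (nat_of_bool _)%:R.
  by apply/eqP/idP; [move=> /val_inj ->; rewrite inE|rewrite inE => ->].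
apply: xget_unique => [|v].
  split; [exact/form_domainP|by apply/bd => z; exact: hit_in|].
  move=> v /(form_domainP hG) sv /bd vB; rewrite !resistance_formE// lee_fin.
  exact: hit_energy_min.
move=> [/(form_domainP hG) sv /bd vB vmin]; apply/funext => z.
apply: hit_energy_unique => //.
rewrite -lee_fin -!resistance_formE//; apply: vmin; first exact/form_domainP.
by apply/bd => y; exact: hit_in.
Qed.

Lemma trace_conductanceC (x y : B) : trace_conductance c x y = trace_conductance c y x.
Proof.
rewrite /trace_conductance eq_sym; case: ifP => // _.
rewrite /trace_form !energy_extension_hit.
by rewrite !resistance_formE// energyC.
Qed.

Lemma trace_conductanceE (x y : B) : x != y -> trace_conductance c x y =
  vertex_weight c (val x) * average c (hit c B (val y)) (val x).
Proof.
move=> xy; have yx : val y != val x by apply: contra_neq xy => /val_inj.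
(* Symmetry comes first because [energy_hit_hit] takes the flux at its second point. *)
rewrite trace_conductanceC /trace_conductance eq_sym (negbTE xy).
rewrite /trace_form !energy_extension_hit resistance_formE// [fine _]/=.
by rewrite (energy_hit_hit hG hrec (Bv y) (Bv x) yx) opprK.
Qed.

Lemma trace_conductancexx (x : B) : trace_conductance c x x = 0.
Proof. by rewrite /trace_conductance eqxx. Qed.

Lemma trace_conductance_ge0 (x y : B) : 0 <= trace_conductance c x y.
Proof.
have [->|xy] := eqVneq x y; first by rewrite trace_conductancexx.
rewrite trace_conductanceE// mulr_ge0 ?vertex_weight_ge0//.
by apply: average_ge0 => // z; exact: h0.
Qed.

(** Probability that the first return to [B] from [x] is at [x] itself: the loop that the trace
    discards. *)
Let tail (x : B) := average c (hit c B (val x)) (val x).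

(** A single formula on and off the diagonal, so that a whole row can be summed. *)
Lemma trace_conductance_diff (x y : B) : trace_conductance c x y =
  vertex_weight c (val x) *
    (average c (hit c B (val y)) (val x) - (val x == val y)%:R * tail x).
Proof.
have [->|xy] := eqVneq x y.
  by rewrite trace_conductancexx /tail eqxx mul1r subrr mulr0.
by rewrite trace_conductanceE// (_ : val x == val y = false) ?mul0r ?subr0//; apply/negbTE.
Qed.

Lemma summ_trace_conductance (x : B) : summ (trace_conductance c x) /\
  rsum (trace_conductance c x) = vertex_weight c (val x) * (1 - tail x).
Proof.
have B0 : B !=set0 by exists (val x).
have [s1 e1] := rsum_average_hit B0 (val x).
have [s2 e2] := indicator_at_point (val x).
have s3 : summ (fun y : B => (val x == val y)%:R * tail x).
  by apply: eq_summ (summZ (tail x) s2) => y; rewrite mulrC.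
have e3 : rsum (fun y : B => (val x == val y)%:R * tail x) = tail x.
  rewrite (@eq_rsum _ _ _ (fun y : B => tail x * (val x == val y)%:R)); last first.
    by move=> y; rewrite mulrC.
  by rewrite rsumZ// e2 indicE mem_set// mulr1.
split.
  by apply: (eq_summ (trace_conductance_diff x)); apply: summZ; exact: summB.
rewrite (eq_rsum (trace_conductance_diff x)) rsumZ; last exact: summB.
by rewrite rsumB// e1 e3.
Qed.

(** The path may leave [B], so the induction carries a point [x] at which [B] is first visited from
    [z] with positive probability. For [z] in [B] this point must be [z]. *)
Lemma trace_reachable z (y : B) (s : seq V) :
  path (fun a b => 0 < c a b) z s -> last z s = val y ->
  exists2 x : B, 0 < hit c B (val x) z &
    exists2 t : seq B, path (fun a b => 0 < trace_conductance c a b) x t & last x t = y.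
Proof.
elim: s z => [|w s IH] z /=.
  move=> _ ->; exists y; last by exists [::].
  by rewrite (hit_self c (Bv y)) ltr01.
move=> /andP[czw] ps ls; have [x xw [t pt lt]] := IH w ps ls.
have pos : 0 < average c (hit c B (val x)) z.
  have h := @term_le_rsum _ _ (fun u => transition c z u * hit c B (val x) u) w.
  apply: lt_le_trans (h _ _); first by rewrite mulr_gt0// transition_gt0.
    by move=> u; rewrite mulr_ge0 ?h0 ?transition_ge0.
  by apply: (summ_average hG z (M := 1)) => u; exact: hit_norm.
have [zB|zB] := boolP (z \in B); last first.
  by exists x; [rewrite (hit_out hG (Bv x))// -notin_setE|exists t].
pose zb : B := SigSub zB; exists zb; first by rewrite hit_self//; exact: set_mem.
have [zx|zx] := eqVneq zb x; first by exists t; rewrite zx.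
exists (x :: t) => //=; rewrite pt andbT trace_conductanceE// mulr_gt0//.
exact: lt_le_trans czw (conductance_le_weight hG _ _).
Qed.

Lemma trace_network : electrical_network (@trace_conductance R V c B).
Proof.
split.
- exact: trace_conductance_ge0.
- exact: trace_conductanceC.
- exact: trace_conductancexx.
- move=> x; have [s _] := summ_trace_conductance x.
  by rewrite /total_conductance rsum_fin ?ltry// => y; exact: trace_conductance_ge0.
- move=> x y; have [s ps ls] := network_connected hG (val x) (val y).
  have [u ux [t pt lt]] := trace_reachable ps ls; exists t => //.
    suff <- : u = x by [].
    move: ux; rewrite hit_in//; case: eqP => [/val_inj//|]; by rewrite ltxx.
  suff <- : u = x by [].
  move: ux; rewrite hit_in//; case: eqP => [/val_inj//|]; by rewrite ltxx.
Qed.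

(** Strong Markov property at the first visit to [B], in analytic form: the visit is at [x], or at
    [u] and the search starts afresh. Both sides are harmonic off [B] and agree on [B], by the
    choice of [al] at [u]. *)
Lemma hit_trace_decomposition (u x : B) z : x != u ->
  hit c (B `\ val u) (val x) z =
  hit c B (val x) z + hit c (B `\ val u) (val x) (val u) * hit c B (val u) z.
Proof.
move=> xu; set D := B `\ val u; set al := hit c D _ (val u).
have xu' : val x <> val u by move=> /val_inj /eqP; rewrite (negbTE xu).
have Dx : D (val x) by split.
have al1 : `|al| <= 1 by exact: hit_norm.
pose g z := hit c D (val x) z - (hit c B (val x) z + al * hit c B (val u) z).
have n1 y : `|hit c B (val x) y| <= 1 by exact: hit_norm.
have n2 y : `|al * hit c B (val u) y| <= 1.
  by rewrite normrM mulr_ile1// hit_norm.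
have n3 y : `|hit c B (val x) y + al * hit c B (val u) y| <= 2.
  rewrite (le_trans (ler_normD _ _))//; have := n1 y; have := n2 y; lra.
have gM y : `|g y| <= 3.
  rewrite (le_trans (ler_normB _ _))//; have := n3 y; have := hit_norm hG Dx y; lra.
have := @bounded_harmonic_eq0 _ _ _ hG hrec B g 3 (ex_intro _ _ (Bv u)) gM => h.
apply/eqP; rewrite -subr_eq0; apply/eqP/h => y yB.
  have [yu|yu] := pselect (y = val u).
    rewrite /g yu -/al (hit_in c (val x) (Bv u)) (hit_self c (Bv u)) mulr1.
    by rewrite (_ : val u == val x = false) ?add0r ?subrr//; apply/eqP/nesym.
  have Dy : D y by split.
  rewrite /g (hit_in c _ Dy) !(hit_in c _ yB) (_ : y == val u = false); last exact/eqP.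
  by rewrite mulr0 addr0 subrr.
rewrite /g (@averageB _ _ _ hG _ _ 1 2)//; last by move=> w; exact: hit_norm.
rewrite (@averageD _ _ _ hG _ _ 1 1)// (@averageZ _ _ _ hG _ _ 1); last first.
  by move=> w; exact: hit_norm.
rewrite -(hit_out hG Dx) => [|[]//].
by rewrite -(hit_out hG (Bv x) yB) -(hit_out hG (Bv u) yB).
Qed.

(** Averaging the decomposition at [u] gives a linear equation for [al]. Nonzero trace weight makes
    both the weight of [u] and [1 - tail u] nonzero, so it can be solved. *)
Lemma trace_transition (u x : B) :
  vertex_weight (@trace_conductance R V c B) u != 0 -> x != u ->
  transition (@trace_conductance R V c B) u x = hit c (B `\ val u) (val x) (val u).
Proof.
move=> w0 xu; rewrite transitionE; [|exact: trace_network|exact: w0].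
move: w0; rewrite vertex_weightE; last exact: trace_network.
have [_ ->] := summ_trace_conductance u.
rewrite trace_conductanceE ?(eq_sym u)// /tail => w0.
set al := hit _ _ _ _.
have Dx : (B `\ val u) (val x) by split => // /val_inj /eqP; rewrite (negbTE xu).
have : al = average c (hit c B (val x)) (val u) + al * average c (hit c B (val u)) (val u).
  rewrite {1}/al (hit_out hG Dx); last by move=> [_]; apply.
  rewrite (eq_average _ _ (fun z => hit_trace_decomposition z xu)).
  have n1 (y : B) w : `|hit c B (val y) w| <= 1 by exact: (hit_norm hG (Bv y)).
  have n2 w : `|al * hit c B (val u) w| <= 1.
    by rewrite normrM mulr_ile1// (hit_norm hG Dx).
  by rewrite (@averageD _ _ _ hG _ _ 1 1)// (@averageZ _ _ _ hG _ _ 1).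
move: w0; rewrite mulf_eq0 negb_or => /andP[w0 t0] e.
apply: (mulIf t0); rewrite -mulf_div divff// mul1r divfK// mulrBr mulr1.
by rewrite {1}e; lra.
Qed.

Lemma trace_transitionxx (u : B) :
  vertex_weight (@trace_conductance R V c B) u != 0 ->
  transition (@trace_conductance R V c B) u u = 0.
Proof.
move=> w0; rewrite transitionE; [|exact: trace_network|exact: w0].
by rewrite trace_conductancexx mul0r.
Qed.

End TraceNetwork.

(** * The Markov property *)

Section CountablePartition.
Context {R : realType} {d : measure_display} {Omega : measurableType d}.
Variable P : probability Omega R.
Implicit Types A : set Omega.

Definition pr A : R := fine (P A).

Lemma prE A : measurable A -> P A = (pr A)%:E.
Proof. by move=> mA; rewrite /pr fineK// fin_num_measure. Qed.

Lemma pr_ge0 A : 0 <= pr A.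
Proof. by rewrite /pr fine_ge0. Qed.

Lemma pr_le A A' : measurable A -> measurable A' -> A `<=` A' -> pr A <= pr A'.
Proof.
by move=> mA mA' AA'; rewrite -lee_fin -!prE// le_measure ?inE.
Qed.

Lemma pr_set0 : pr set0 = 0.
Proof. by rewrite /pr measure0. Qed.

Lemma measurable_bigcup_count (I : countType) (F : I -> set Omega) :
  (forall i, measurable (F i)) -> measurable (\bigcup_i F i).
Proof. by apply: countable_bigcupT_measurable; exact: countableP. Qed.

Lemma pr_partition (T : countType) (X : Omega -> T) A : measurable A ->
  (forall t, measurable (X @^-1` [set t])) ->
  summ (fun t => pr (A `&` X @^-1` [set t])) /\
  rsum (fun t => pr (A `&` X @^-1` [set t])) = pr A.
Proof.
move=> mA mX.
have mAX t : measurable (A `&` X @^-1` [set t]) by exact: measurableI.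
(* Countable additivity is indexed by [nat]; numbers that code no value give the empty set. *)
pose F n := A `&` [set w | pickle (X w) = n].
have FE n : F n = if @pickle_inv T n is Some t then A `&` X @^-1` [set t] else set0.
  apply/seteqP; split => w.
    by move=> [Aw /= <-]; rewrite pickleK_inv.
  have := @pickle_invK T n; case: (pickle_inv (T := T) n) => //= t tn [Aw /= Xw].
  by split => //=; rewrite Xw.
have mF n : measurable (F n) by rewrite FE; case: (pickle_inv (T := T) n).
have AF : A = \bigcup_n F n.
  apply/seteqP; split => [w Aw|w [n _ []//]].
  by exists (pickle (X w)).
have tF : trivIset setT F.
  by move=> i j _ _ [w [[_ /= <-] [_ /= <-]]].
have E : (P A = \esum_(t in [set: T]) (pr (A `&` X @^-1` [set t]))%:E)%E.
  rewrite {1}AF measure_semi_bigcup//; last exact: bigcupT_measurable.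
  rewrite nneseries_esumT//.
  transitivity (\esum_(n in range (@pickle T)) P (F n))%E.
    rewrite [RHS]esum_mkcond; apply: eq_esum => n _; case: ifPn => // /negP nr.
    rewrite FE; have := @pickle_invK T n; case: (pickle_inv (T := T) n) => //= t tn.
    by case: nr; rewrite inE; exists t.
  rewrite esum_image; last by move=> s t _ _; apply: (pcan_inj (@pickleK T)).
  by apply: eq_esum => t _; rewrite FE pickleK_inv prE.
have pge0 t : 0 <= pr (A `&` X @^-1` [set t]) by exact: pr_ge0.
have sm : summ (fun t => pr (A `&` X @^-1` [set t])).
  by apply: summ_fin => //; rewrite -E prE// ltry.
by split => //; apply: EFin_inj; rewrite -rsum_fin// -E prE.
Qed.

Lemma pr_nondecreasing_cvg (F : nat -> set Omega) :
  (forall n, measurable (F n)) -> (forall n, F n `<=` F n.+1) ->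
  pr (F n) @[n --> \oo] --> pr (\bigcup_n F n).
Proof.
move=> mF FS; have mU := bigcupT_measurable F mF.
have ndF : nondecreasing_seq F by apply/nondecreasing_seqP => n; apply/subsetPset.
have h : (fun n => P (F n)) @ \oo --> P (\bigcup_n F n) by exact: nondecreasing_cvg_mu.
move: h; rewrite (prE mU) (_ : (fun n => P (F n)) = EFin \o (fun n => pr (F n))).
  by move/fine_cvgP => [].
by apply/funext => n /=; rewrite prE.
Qed.

End CountablePartition.

Section Words.
Context {R : realType} {V : countType}.
Context {d : measure_display} {Omega : measurableType d}.
Variables (P : probability Omega R) (Y : nat -> Omega -> V).
Hypothesis mY : forall n (A : set V), measurable (Y n @^-1` A).

Definition agree m (v : nat -> V) : set Omega :=
  [set w | forall i, (i <= m)%N -> Y i w = v i].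

Definition word m (w : Omega) : {ffun 'I_m.+1 -> V} := [ffun i : 'I_m.+1 => Y i w].

(** Only indices up to [m] are meaningful; beyond, [inord] falls back to index 0. *)
Definition extend m (t : {ffun 'I_m.+1 -> V}) i : V := t (inord i).

Lemma extendK m (t : {ffun 'I_m.+1 -> V}) : [ffun i : 'I_m.+1 => extend t i] = t.
Proof. by apply/ffunP => i; rewrite ffunE /extend inord_val. Qed.

Lemma extend_word m w i : (i <= m)%N -> extend (word m w) i = Y i w.
Proof. by move=> im; rewrite /extend /word ffunE inordK. Qed.

Lemma measurable_agree m v : measurable (agree m v).
Proof.
rewrite (_ : agree m v = \bigcap_(i in [set i | (i <= m)%N]) Y i @^-1` [set v i]).
  by apply: bigcap_measurableType => i _; exact: mY.
by apply/seteqP; split.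
Qed.

Lemma word_preimage m t : word m @^-1` [set t] = agree m (extend t).
Proof.
apply/seteqP; split => w /=.
  by move=> <- i im; rewrite extend_word.
move=> h; rewrite -[RHS]extendK; apply/ffunP => i; rewrite !ffunE h//.
by rewrite -ltnS.
Qed.

Lemma measurable_word m t : measurable (word m @^-1` [set t]).
Proof. by rewrite word_preimage; exact: measurable_agree. Qed.

Lemma rsum_agree m : summ (fun t : {ffun 'I_m.+1 -> V} => pr P (agree m (extend t))) /\
  rsum (fun t : {ffun 'I_m.+1 -> V} => pr P (agree m (extend t))) = 1.
Proof.
have [s e] := pr_partition P measurableT (measurable_word (m := m)).
have E t : pr P (agree m (extend t)) = pr P (setT `&` word m @^-1` [set t]).
  by rewrite setTI word_preimage.
split; first exact: eq_summ E s.
by rewrite (eq_rsum E) e /pr probability_setT.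
Qed.

End Words.

(** * Events of the chain, and first visits after a fixed time *)

Section Markov.
Context {R : realType} {V : countType}.
Variable c : V -> V -> R.
Hypothesis hG : electrical_network c.
Context {d : measure_display} {Omega : measurableType d}.
Variables (P : probability Omega R) (Y : nat -> Omega -> V) (x0 : V).
Hypothesis hY : markov_chain c x0 P Y.
Implicit Types (E : set (nat -> V)) (A : set V) (y : nat -> V).

Definition event E : set Omega := [set w | E (fun n => Y n w)].

(** Stands for membership in the sigma-algebra of the coordinates up to [m]: as [V] is countable,
    such an event is a countable union of words. *)
Definition determined m E := forall y y',
  (forall i, (i <= m)%N -> y i = y' i) -> E y -> E y'.

Let mY := chain_measurable hY.

Lemma event_coord n A : measurable (event [set y | A (y n)]).
Proof. exact: chain_measurable hY n A. Qed.

Lemma event_bigcup (I : countType) (F : I -> set (nat -> V)) :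
  (forall i, measurable (event (F i))) -> measurable (event (\bigcup_i F i)).
Proof.
move=> mF; rewrite (_ : event _ = \bigcup_i event (F i)).
  exact: measurable_bigcup_count.
by apply/seteqP; split => w [i _ h]; exists i.
Qed.

Lemma eventI E E' : measurable (event E) -> measurable (event E') ->
  measurable (event (E `&` E')).
Proof. exact: measurableI. Qed.

Lemma eventC E : measurable (event E) -> measurable (event (~` E)).
Proof. exact: measurableC. Qed.

Lemma eventU E E' : measurable (event E) -> measurable (event E') ->
  measurable (event (E `|` E')).
Proof. exact: measurableU. Qed.

Lemma event_determined m E : determined m E -> measurable (event E).
Proof.
move=> dE.
rewrite (_ : event E = \bigcup_(t in [set: {ffun 'I_m.+1 -> V}])
    (if `[< E (extend t) >] then word Y m @^-1` [set t] else set0)).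
  by apply: measurable_bigcup_count => t; case: ifP => // _; exact: measurable_word.
apply/seteqP; split => w.
  move=> Ew; exists (word Y m w) => //; rewrite ifT//; apply/asboolP.
  apply: (dE _ _ _ Ew) => i im; by rewrite extend_word.
move=> [t _]; case: asboolP => // Et /= wt; move: Et; rewrite -wt => Et.
by apply: (dE _ _ _ Et) => i im; rewrite /extend /word ffunE inordK.
Qed.

(** [chain_step] speaks of single words; sum it over the words that make up [E], all ending at
    [z]. *)
Lemma chain_step_event m E z z' : determined m E -> (forall y, E y -> y m = z) ->
  pr P (event (E `&` [set y | y m.+1 = z'])) = pr P (event E) * transition c z z'.
Proof.
move=> dE Ez; have mE := event_determined dE.
have mE' : measurable (event (E `&` [set y | y m.+1 = z'])).
  by apply: eventI => //; exact: (@event_coord m.+1 [set z']).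
have [s1 <-] := pr_partition P mE (measurable_word mY (m := m)).
have [s2 <-] := pr_partition P mE' (measurable_word mY (m := m)).
rewrite mulrC -rsumZ//; apply: eq_rsum => t; rewrite mulrC.
pose v i := if (i <= m)%N then extend t i else z'.
have vt i : (i <= m)%N -> v i = extend t i by rewrite /v => ->.
have vS : v m.+1 = z' by rewrite /v ltnn.
have [Et|Et] := pselect (E (extend t)); last first.
  have -> : event E `&` word Y m @^-1` [set t] = set0.
    rewrite word_preimage; apply/seteqP; split => // w [Ew h].
    by apply: Et; apply: (dE _ _ _ Ew).
  have -> : event (E `&` [set y | y m.+1 = z']) `&` word Y m @^-1` [set t] = set0.
    rewrite word_preimage; apply/seteqP; split => // w [[Ew _] h].
    by apply: Et; apply: (dE _ _ _ Ew).
  by rewrite pr_set0 mul0r.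
have e1 : event E `&` word Y m @^-1` [set t] =
    agree Y m v.
  rewrite word_preimage; apply/seteqP; split => [w [_ h] i im|w h].
    by rewrite vt// h.
  split; last by move=> i im; rewrite h ?vt.
  by apply: (dE _ _ _ Et) => i im; rewrite h// vt.
have e2 : event (E `&` [set y | y m.+1 = z']) `&` word Y m @^-1` [set t] =
    agree Y m.+1 v.
  rewrite word_preimage; apply/seteqP; split => [w [[_ /= Yz] h] i|w h].
    rewrite leq_eqVlt => /orP[/eqP ->|]; last by move=> im; rewrite vt// h.
    by rewrite /v ltnn.
  split; last by move=> i im; rewrite h ?vt// leqW.
  split; last by rewrite /= h// /v ltnn.
  by apply: (dE _ _ _ Et) => i im; rewrite h ?vt// leqW.
rewrite e1 e2; apply: EFin_inj; rewrite EFinM -!prE; [|exact: measurable_agree..].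
by rewrite (chain_step hY) vS vt// (Ez _ Et).
Qed.

(** The clock starts at time [m], and time [m] itself counts as a visit, as in [hit_within]. *)
Definition hits_within D x m n y : Prop := exists j, [/\ (m <= j <= m + n)%N, y j = x &
  forall i, (m <= i < j)%N -> ~ D (y i)].

Lemma event_hits_within D x m n : measurable (event (hits_within D x m n)).
Proof.
apply: (@event_determined (m + n)) => y y' yy' [j [/andP[mj jn] yj h]].
exists j; split; [by rewrite mj|by rewrite -yy'|].
move=> i /andP[mi ij]; rewrite -yy'; first by apply: h; rewrite mi.
by rewrite (leq_trans (ltnW ij)).
Qed.

(** First-step analysis: off [D], the induction hypothesis is used at time [m.+1] for [E]
    intersected with each value of the next position, which is why [m], [E] and [z] vary. *)
Lemma pr_hits_within D x m n E z : D x -> determined m E -> (forall y, E y -> y m = z) ->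
  pr P (event (E `&` hits_within D x m n)) = pr P (event E) * hit_within c D x n z.
Proof.
move=> Dx; elim: n m E z => [|n IH] m E z dE Ez.
  have [zx|zx] := eqVneq z x; rewrite /= ?zx ?eqxx ?(negbTE zx) ?mulr1 ?mulr0.
    congr (pr P (event _)); apply/seteqP; split => [y []//|y Ey]; split => //.
    exists m; split; [by rewrite addn0 leqnn|by rewrite (Ez _ Ey)|].
    by move=> i /andP[mi im]; move: (leq_ltn_trans mi im); rewrite ltnn.
  rewrite (_ : E `&` _ = set0) ?pr_set0//; apply/seteqP; split => // y [Ey [j []]].
  rewrite addn0 => mjm yj _; move: zx; rewrite -(Ez _ Ey) -yj.
  by rewrite (anti_leq mjm) eqxx.
have [Dz|Dz] := pselect (D z).
  rewrite hit_within_in//; have [zx|zx] := eqVneq z x; rewrite ?mulr1 ?mulr0.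
    congr (pr P (event _)); apply/seteqP; split => [y []//|y Ey]; split => //.
    exists m; split; [by rewrite leqnn leq_addr|by rewrite (Ez _ Ey)|].
    by move=> i /andP[mi im]; move: (leq_ltn_trans mi im); rewrite ltnn.
  rewrite (_ : E `&` _ = set0) ?pr_set0//; apply/seteqP; split => // y [Ey [j []]].
  move=> /andP[mj _] yj h; move: mj; rewrite leq_eqVlt => /orP[/eqP mj|mj].
    by move: zx; rewrite -(Ez _ Ey) -yj mj eqxx.
  by apply: (h m); rewrite ?leqnn// (Ez _ Ey).
have mE := event_determined dE.
rewrite hit_within_out// /average -rsumZ; last first.
  by apply: (summ_average hG _ (M := 1)) => w; exact: hit_within_norm.
have mEH : measurable (event (E `&` hits_within D x m n.+1)).
  by apply: eventI => //; exact: event_hits_within.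
have [s <-] := pr_partition P mEH (fun w => @event_coord m.+1 [set w]).
apply: eq_rsum => w; rewrite mulrA -(chain_step_event w dE Ez) -(IH m.+1); last 2 first.
- move=> y y' yy' [Ey /= yw]; split; last by rewrite /= -yy'.
  by apply: (dE _ _ _ Ey) => i im; rewrite yy'// leqW.
- by move=> y [].
congr (pr P _); apply/seteqP; split => o.
  move=> [[Eo [j [/andP[mj jn] yj h]]] /= Yw]; split; first by split.
  move: mj; rewrite leq_eqVlt => /orP[/eqP mj|mj].
    by case: Dz; rewrite -(Ez _ Eo) mj yj.
  exists j; split; [by rewrite mj addSnnS|by []|].
  by move=> i /andP[mi ij]; apply: h; rewrite (ltnW mi).
move=> [[Eo /= Yw] [j [/andP[mj jn] yj h]]]; split; last by [].
split; first by [].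
exists j; split; [by rewrite (ltnW mj) -addSnnS|by []|].
move=> i /andP[]; rewrite leq_eqVlt => /orP[/eqP <- _|mi ij].
  by rewrite (Ez _ Eo).
by apply: h; rewrite mi.
Qed.

Definition hits D x m y : Prop := exists n, hits_within D x m n y.

Lemma pr_hits D x m E z : D x -> determined m E -> (forall y, E y -> y m = z) ->
  pr P (event (E `&` hits D x m)) = pr P (event E) * hit c D x z.
Proof.
move=> Dx dE Ez; have mE := event_determined dE.
have -> : event (E `&` hits D x m) = \bigcup_n event (E `&` hits_within D x m n).
  apply/seteqP; split => w; first by move=> [Ew [n h]]; exists n.
  by move=> [n _ [Ew h]]; split => //; exists n.
have h1 : pr P (event (E `&` hits_within D x m n)) @[n --> \oo] -->
    pr P (\bigcup_n event (E `&` hits_within D x m n)).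
  apply: pr_nondecreasing_cvg => n.
    by apply: eventI => //; exact: event_hits_within.
  move=> w [Ew [j [/andP[mj jn] yj h]]]; split => //; exists j; split => //.
  by rewrite mj addnS leqW.
apply: (cvg_unique _ h1) => //.
rewrite (_ : (fun n => _) = fun n => pr P (event E) * hit_within c D x n z).
  by apply: cvgM; [exact: cvg_cst|exact: hit_within_cvg].
by apply/funext => n; exact: pr_hits_within.
Qed.

End Markov.

(** * The trace of the chain *)

Section TraceTime.
Context {V : countType} (B : set V).
Implicit Types y : nat -> V.

Definition next_visit y m n : Prop :=
  [/\ (m < n)%N, B (y n), y n <> y m & forall i, (m < i < n)%N -> B (y i) -> y i = y m].

Lemma trace_time_next y k n : next_visit y (trace_time B y k) n ->
  trace_time B y k.+1 = n.
Proof.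
move=> [mn Bn ynm between]; rewrite /=; case: pselect => [ex|]; last first.
  by case; exists n; rewrite mn mem_set//; apply/eqP.
case: ex_minnP => i /and3P[mi Bi yi] imin; apply/eqP; rewrite eqn_leq; apply/andP; split.
  by apply: imin; rewrite mn mem_set//; apply/eqP.
rewrite leqNgt; apply/negP => ni; move/eqP: yi; apply; apply: between.
  by rewrite mi.
exact: set_mem.
Qed.

Lemma trace_timeS y k : (trace_time B y k < trace_time B y k.+1)%N ->
  next_visit y (trace_time B y k) (trace_time B y k.+1).
Proof.
rewrite /=; case: pselect => [ex|]; last by rewrite ltnn.
case: ex_minnP => i /and3P[mi Bi /eqP yi] imin _; split => //; first exact: set_mem.
move=> j /andP[mj ji] Bj; apply: contrapT => /eqP yj.
have : (i <= j)%N by apply: imin; rewrite mj mem_set.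
by rewrite leqNgt ji.
Qed.

Lemma trace_timeS_eq y k : ~ (exists n, next_visit y (trace_time B y k) n) ->
  trace_time B y k.+1 = trace_time B y k.
Proof.
move=> h; rewrite /=; case: pselect => // ex; case: h.
have : (trace_time B y k < trace_time B y k.+1)%N.
  by rewrite /=; case: pselect => // ex'; case: ex_minnP => i /and3P[].
by move=> /trace_timeS; exists (trace_time B y k.+1).
Qed.

Lemma leq_trace_timeS y k : (trace_time B y k <= trace_time B y k.+1)%N.
Proof.
rewrite /=; case: pselect => // ex; case: ex_minnP => i /and3P[mi _ _] _.
exact: ltnW.
Qed.

Lemma leq_trace_time y i k : (i <= k)%N -> (trace_time B y i <= trace_time B y k)%N.
Proof.
elim: k => [|k IH]; first by rewrite leqn0 => /eqP ->.
rewrite leq_eqVlt => /orP[/eqP -> //|]; rewrite ltnS => /IH h.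
exact: leq_trans h (leq_trace_timeS _ _).
Qed.

(* Unlike [trace_chain], this requires the first [k] moves of the trace to exist:
   the path does return to [B]. *)
Definition traces (u : nat -> B) k : set (nat -> V) :=
  [set y | (forall i, (i < k)%N -> trace_time B y i < trace_time B y i.+1)%N /\
           (forall i, (i <= k)%N -> y (trace_time B y i) = val (u i))].

Definition traces_at (u : nat -> B) k m : set (nat -> V) :=
  traces u k `&` [set y | trace_time B y k = m].

(** Staying put for want of a further visit depends on the whole future. Strict increase excludes
    this, and the trace time then behaves as a stopping time. *)
Lemma trace_time_agree y y' k m : (forall i, (i <= m)%N -> y i = y' i) ->
  (trace_time B y k <= m)%N ->
  (forall i, (i < k)%N -> trace_time B y i < trace_time B y i.+1)%N ->
  trace_time B y' k = trace_time B y k.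
Proof.
move=> yy'; elim: k => // k IH km inc.
have km' : (trace_time B y k <= m)%N by rewrite (leq_trans _ km)// leq_trace_timeS.
have e : trace_time B y' k = trace_time B y k.
  by apply: IH => // i ik; apply: inc; rewrite leqW.
have [lt Bn yn between] := trace_timeS (inc k (ltnSn k)).
apply: trace_time_next; rewrite e; split; rewrite -?yy'//.
move=> i /andP[mi ij] Bi; have im : (i <= m)%N by rewrite (leq_trans (ltnW ij)).
by rewrite -yy'//; apply: between; rewrite ?mi// yy'.
Qed.

Lemma traces_at_determined u k m : determined m (traces_at u k m).
Proof.
move=> y y' yy' [[inc vis] /= tk].
have e i : (i <= k)%N -> trace_time B y' i = trace_time B y i.
  move=> ik; apply: (trace_time_agree yy').
    by rewrite -tk leq_trace_time.
  by move=> j ji; apply: inc; rewrite (leq_trans ji).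
split; last by rewrite /= e.
split => i ik; first by rewrite !e ?inc// ltnW.
by rewrite e// -yy' ?vis// -tk leq_trace_time.
Qed.

(** The next trace move is the first visit to [B] without [u k]. Counting from time [m] rather than
    [m.+1] is harmless, since the path is then at [u k]. *)
Lemma traces_atS u k m : u k.+1 != u k ->
  traces u k.+1 `&` [set y | trace_time B y k = m] =
  traces_at u k m `&` hits (B `\ val (u k)) (val (u k.+1)) m.
Proof.
move=> uk; have uk' : val (u k.+1) <> val (u k) by move=> /val_inj /eqP; rewrite (negbTE uk).
apply/seteqP; split => y.
  move=> [[inc vis] /= tk]; split.
    by split => //; split => i ik; [apply: inc|apply: vis]; rewrite leqW.
  have := trace_timeS (inc k (ltnSn k)).
  set n := trace_time B y k.+1; rewrite tk => -[mn Bn yn between].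
  have ym : y m = val (u k) by rewrite -tk vis.
  exists (n - m)%N, n; split.
  - by rewrite subnKC ?leqnn ?andbT// ltnW.
  - by rewrite vis.
  - move=> i /andP[]; rewrite leq_eqVlt => /orP[/eqP <- _ [_]|mi ij [Bi]]; apply.
      exact: ym.
    by rewrite /= between ?mi.
move=> [[[inc vis] /= tk] [_ [n [/andP[mn _] yn h]]]]; split; last by [].
have {}yn : y n = val (u k.+1) := yn.
have ym : y m = val (u k) by rewrite -tk vis.
have mn' : (m < n)%N.
  rewrite ltn_neqAle mn andbT; apply/eqP => mn'; apply: uk'.
  by rewrite -yn -mn' ym.
have tn : trace_time B y k.+1 = n.
  apply: trace_time_next; rewrite tk; split => //.
  - by rewrite yn; exact: set_valP.
  - by rewrite yn ym.
  - move=> i /andP[mi ij] Bi; rewrite ym; apply: contrapT => yi.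
    by apply: (h i); [rewrite (ltnW mi)|split].
split => i.
  by rewrite ltnS leq_eqVlt => /orP[/eqP ->|]; [rewrite tn tk|exact: inc].
by rewrite leq_eqVlt => /orP[/eqP ->|]; [rewrite tn|rewrite ltnS; exact: vis].
Qed.

Lemma traces_chain rho u k y : traces u k y ->
  forall i, (i <= k)%N -> trace_chain rho y i = u i.
Proof. by move=> [_ vis] i ik; rewrite /trace_chain vis// valKd. Qed.

End TraceTime.

(** * Finite-dimensional distributions of the trace *)

Section TraceLaw.
Context {R : realType} {V : countType}.
Variable c : V -> V -> R.
Hypothesis hG : electrical_network c.
Hypothesis hrec : recurrent c.
Variables (B : set V) (rho : B).
Context {d : measure_display} {Omega : measurableType d}.
Variables (P : probability Omega R) (Y : nat -> Omega -> V).
Hypothesis hY : markov_chain c (val rho) P Y.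
Context {d' : measure_display} {Omega' : measurableType d'}.
Variables (P' : probability Omega' R) (Z : nat -> Omega' -> B).
Hypothesis hZ : markov_chain (@trace_conductance R V c B) rho P' Z.

Implicit Type u : nat -> B.

Let tr k w : B := trace_chain rho (fun n => Y n w) k.

Lemma measurable_trace_time k m :
  measurable (event Y [set y | trace_time B y k = m]).
Proof.
have mnext i j : measurable (event Y [set y | next_visit B y i j]).
  apply: (event_determined hY (m := maxn i j)) => y y' yy' [ij Bj yj between].
  have yi l : (l <= i)%N -> y l = y' l by move=> li; apply: yy'; rewrite leq_max li.
  have yl l : (l <= j)%N -> y l = y' l by move=> lj; apply: yy'; rewrite leq_max lj orbT.
  split; rewrite -?(yi i (leqnn i)) -?(yl j (leqnn j))// => l /andP[il lj].
  by rewrite -(yl l (ltnW lj)); apply: between; rewrite il.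
elim: k m => [|k IH] m.
  have [->|m0] := eqVneq m 0%N.
    by rewrite (_ : event Y _ = setT)//; apply/seteqP; split.
  rewrite (_ : event Y _ = set0)//; apply/seteqP; split => // w /= e.
  by rewrite -e eqxx in m0.
(* Either the next visit occurs at [m], or [i = m] and no next visit exists, an event not determined
   by finitely many coordinates. *)
rewrite (_ : [set y | _] = \bigcup_i ([set y | trace_time B y k = i] `&`
    ([set y | next_visit B y i m] `|`
     (if i == m then ~` \bigcup_n [set y | next_visit B y i n] else set0)))).
  apply: event_bigcup => i; apply: eventI => //; apply: eventU => //.
  case: ifP => // _; last by rewrite (_ : event Y _ = set0)//; apply/seteqP; split.
  by apply: eventC; apply: event_bigcup => n.
apply/seteqP; split => y.
  move=> tm; have {tm}<- : trace_time B y k.+1 = m := tm.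
  exists (trace_time B y k) => //; split => //.
  have [[n nv]|no] := pselect (exists n, next_visit B y (trace_time B y k) n).
    by left; rewrite (trace_time_next nv).
  right; rewrite (trace_timeS_eq no) eqxx => -[n _ nv].
  by apply: no; exists n.
move=> [i _ [/= <- []]]; first exact: trace_time_next.
case: eqP => // <- no; apply: trace_timeS_eq => -[n nv].
by apply: no; exists n.
Qed.

Lemma measurable_trace_chain k (A : set B) : measurable (tr k @^-1` A).
Proof.
rewrite (_ : tr k @^-1` A = \bigcup_m event Y ([set y | trace_time B y k = m] `&`
    [set y | A (insubd rho (y m))])).
  apply: bigcupT_measurable => m; apply: eventI; first exact: measurable_trace_time.
  exact: (event_coord hY m [set x | A (insubd rho x)]).
apply/seteqP; split => w; first by exists (trace_time B (Y ^~ w) k).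
by move=> [m _ [/= <-]].
Qed.

Lemma measurable_traces u k : measurable (event Y (traces u k)).
Proof.
rewrite (_ : event Y _ = \bigcup_m event Y (traces_at u k m)).
  apply: bigcupT_measurable => m.
  exact: (event_determined hY (@traces_at_determined _ _ u k m)).
apply/seteqP; split => w; last by move=> [m _ []].
by exists (trace_time B (Y ^~ w) k).
Qed.

(** Strong Markov property at the [k]-th trace time: partition by its value [m] and use [pr_hits] at
    that fixed time. *)
Lemma pr_tracesS u k : pr P (event Y (traces u k.+1)) =
  pr P (event Y (traces u k)) *
  (if u k.+1 == u k then 0 else hit c (B `\ val (u k)) (val (u k.+1)) (val (u k))).
Proof.
case: eqVneq => [e|uk].
  rewrite mulr0 (_ : event Y _ = set0) ?pr_set0//; apply/seteqP; split => // w [inc vis].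
  have [_ _] := trace_timeS (inc k (ltnSn k)).
  by rewrite vis// vis// ?e//.
have [s1 <-] := pr_partition P (measurable_traces u k) (measurable_trace_time k).
have [s2 <-] := pr_partition P (measurable_traces u k.+1) (measurable_trace_time k).
rewrite mulrC -rsumZ//; apply: eq_rsum => m; rewrite mulrC.
have Dx : (B `\ val (u k)) (val (u k.+1)).
  by split; [exact: set_valP|move=> /val_inj /eqP; rewrite (negbTE uk)].
have tz y : traces_at u k m y -> y m = val (u k) by move=> [[_ vis] /= <-]; rewrite vis.
have := pr_hits hG hY Dx (@traces_at_determined _ _ u k m) tz.
by rewrite -traces_atS.
Qed.

Lemma pr_start (T : countType) (c' : T -> T -> R) (x : T) (e : measure_display)
    (W : measurableType e) (Q : probability W R) (X : nat -> W -> T) v :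
  markov_chain c' x Q X -> pr Q (X 0%N @^-1` [set v]) = (v == x)%:R.
Proof.
move=> hX; have mX := chain_measurable hX; have st := chain_start hX.
have [->|vx] := eqVneq v x; first by rewrite /pr st.
apply/eqP; rewrite eq_le pr_ge0 andbT.
have le : (Q (X 0%N @^-1` [set v]) <= 1 - Q (X 0%N @^-1` [set x]))%E.
  rewrite -probability_setC//.
  apply: le_measure; rewrite ?inE//; first exact: measurableC.
  by move=> w /= ->; apply/eqP.
by rewrite -lee_fin -prE// (le_trans le)// st subee.
Qed.

(** The hypothesis excludes a one-point [B], for which no genuine move exists although the chain of
    the trace network stays put with probability 1. *)
Lemma pr_traces u k :
  (forall x, vertex_weight (@trace_conductance R V c B) x != 0) ->
  pr P (event Y (traces u k)) = pr P' (agree Z k u).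
Proof.
move=> w0; elim: k => [|k IH].
  transitivity (pr P (Y 0%N @^-1` [set val (u 0%N)])).
    congr (pr P _); apply/seteqP; split => w /=; first by move=> [_ /(_ 0%N)]; apply.
    by move=> h; split => // i; rewrite leqn0 => /eqP ->.
  transitivity (pr P' (Z 0%N @^-1` [set u 0%N])).
    by rewrite (pr_start _ hY) (pr_start _ hZ) (inj_eq val_inj).
  congr (pr P' _); apply/seteqP; split => w /=; last by apply.
  by move=> h i; rewrite leqn0 => /eqP ->.
rewrite pr_tracesS IH; apply: EFin_inj.
have mZ := chain_measurable hZ.
rewrite -[RHS]prE; last exact: measurable_agree.
rewrite /agree (chain_step hZ) EFinM -prE; last exact: measurable_agree.
congr (_ * _%:E)%E; case: eqVneq => [->|uk].
  by rewrite trace_transitionxx.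
by rewrite trace_transition.
Qed.

Lemma pr_trace_chain u k : pr P (agree tr k u) = pr P' (agree Z k u).
Proof.
have hT := trace_network hG B hrec.
have [w0|] := pselect (forall x, vertex_weight (@trace_conductance R V c B) x != 0).
  have mZ := chain_measurable hZ; have mtr := measurable_trace_chain.
  have [s1 e1] := rsum_agree P mtr k.
  have [s2 e2] := rsum_agree P' mZ k.
  (* The differences are nonnegative and, both families having total mass 1, sum to 0; hence each of
     them is 0. *)
  have le t : 0 <= pr P (agree tr k (@extend _ k t)) - pr P' (agree Z k (extend t)).
    rewrite subr_ge0 -pr_traces//; apply: pr_le.
    - exact: measurable_traces.
    - exact: measurable_agree.
    - by move=> w h i ik; apply: (traces_chain _ h).
  have e3 := rsumB s1 s2; rewrite e1 e2 subrr in e3.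
  pose t : {ffun 'I_k.+1 -> B} := [ffun i : 'I_k.+1 => u i].
  have et i : (i <= k)%N -> extend t i = u i.
    by move=> ik; rewrite /extend ffunE inordK.
  have ag (W : Type) (X : nat -> W -> B) : [set w | forall i, (i <= k)%N -> X i w = extend t i] =
      [set w | forall i, (i <= k)%N -> X i w = u i].
    by apply/seteqP; split => w h i ik; rewrite h ?et.
  have := term_le_rsum t le (summB s1 s2); rewrite e3 /agree !ag => le0.
  apply/eqP; rewrite -subr_eq0 eq_le le0 /=.
  by have := le t; rewrite /agree !ag.
move=> /existsNP[x /negP/negPn/eqP x0].
have all v w : v = w :> B by rewrite (weight0_single hT v x0) (weight0_single hT w x0).
have trT : agree tr k u = setT by apply/seteqP; split => // w _ i _.
have ZT : agree Z k u = setT by apply/seteqP; split => // w _ i _.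
by rewrite trT ZT /pr !probability_setT.
Qed.

End TraceLaw.

(** * Laws on the path space *)

Section CylinderLaw.
Context {R : realType} {B : countType}.
Implicit Types (u y : nat -> B) (s : seq B).

Definition cylinder k u : set (nat -> B) := [set y | forall i, (i <= k)%N -> y i = u i].

Definition cylinders : set (set (nat -> B)) :=
  [set C | C = set0 \/ exists k u, C = cylinder k u].

Lemma cylinders_setI : setI_closed cylinders.
Proof.
move=> C C' [->|[k [u ->]]]; first by rewrite set0I; left.
move=> [->|[k' [u' ->]]]; first by rewrite setI0; left.
have sub (l l' : nat) (v v' : nat -> B) : (l <= l')%N ->
    cylinders (cylinder l v `&` cylinder l' v').
  move=> ll'; have [vv'|vv'] := pselect (forall i, (i <= l)%N -> v' i = v i).
    right; exists l', v'; apply/seteqP; split => [y []//|y h].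
    by split => // i il; rewrite h ?vv'// (leq_trans il).
  left; apply/seteqP; split => // y [h h']; apply: vv' => i il.
  by rewrite -h// h'// (leq_trans il).
by have [|/ltnW] := leqP k k' => kk; [|rewrite setIC]; exact: sub.
Qed.

(** [W] is the union of the cylinders it contains, and cylinders are coded by a length and a finite
    sequence, hence countably many. *)
Lemma open_sigma_cylinders (W : set (nat -> B)) :
  (forall y, W y -> exists k, cylinder k y `<=` W) -> <<s cylinders >> W.
Proof.
move=> hW; have [s0 sC sU] := smallest_sigma_algebra setT cylinders.
have [[r]|noB] := pselect (inhabited B); last first.
  rewrite (_ : W = set0)//; apply/seteqP; split => // y _.
  by apply: noB; constructor; exact: (y 0%N).
pose cyl (p : nat * seq B) := cylinder p.1 (nth r p.2).
pose F n := if @pickle_inv (nat * seq B)%type n is Some p then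
   if `[< cyl p `<=` W >] then cyl p else set0 else set0.
rewrite (_ : W = \bigcup_n F n).
  apply: sU => n; rewrite /F; case: pickle_inv => // p; case: ifP => // _.
  by apply: sub_sigma_algebra; right; exists p.1, (nth r p.2).
apply/seteqP; split => [y Wy|y [n _]]; last first.
  by rewrite /F; case: pickle_inv => // p; case: asboolP => // h /h.
have [k hk] := hW y Wy.
have ny i : (i <= k)%N -> nth r (mkseq y k.+1) i = y i by move=> ik; rewrite nth_mkseq.
exists (pickle (k, mkseq y k.+1)) => //; rewrite /F pickleK_inv.
rewrite ifT; first by move=> i ik /=; rewrite ny.
by apply/asboolP => z h; apply: hk => i ik; rewrite h ?ny.
Qed.

Lemma step_path_open (U : set (skorohod R B)) : open U ->
  <<s cylinders >> (step_path @^-1` U).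
Proof.
move=> oU; apply: open_sigma_cylinders => y Uy.
have [T [e [e0 TU]]] := oU _ Uy.
(* Step paths whose sequences agree up to [Num.truncn T] coincide on [0, T], so the identity time
   change works for every radius. *)
exists (Num.truncn T) => z zy /=; apply: TU; exists id.
  by split => // t; exists t.
move=> t tT; rewrite subrr normr0; split => //=.
by apply: zy; exact: le_truncn.
Qed.

Lemma step_path_borel A : skorohod_borel R B A ->
  <<s cylinders >> (step_path @^-1` A).
Proof.
have [s0 sC sU] := smallest_sigma_algebra setT cylinders.
move: A; apply: smallest_sub; last exact: step_path_open.
split; first by rewrite /= preimage_set0.
  by move=> A /sC; rewrite !setTD.
by move=> F /sU; rewrite /= preimage_bigcup.
Qed.

Section Laws.
Context {d : measure_display} {Omega : measurableType d}.
Context {d' : measure_display} {Omega' : measurableType d'}.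
Variables (P : probability Omega R) (P' : probability Omega' R).
Variables (X : nat -> Omega -> B) (X' : nat -> Omega' -> B).
Hypothesis mX : forall k A, measurable (X k @^-1` A).
Hypothesis mX' : forall k A, measurable (X' k @^-1` A).
Hypothesis agreeE : forall k u, pr P (agree X k u) = pr P' (agree X' k u).

(** Dynkin's theorem, with measurability carried along with the equality of probabilities. *)
Lemma sigma_cylinders_law A : <<s cylinders >> A ->
  [/\ measurable [set w | A (X ^~ w)], measurable [set w | A (X' ^~ w)] &
      P [set w | A (X ^~ w)] = P' [set w | A (X' ^~ w)]].
Proof.
rewrite -(setI_closed_g_dynkin_g_sigma_algebra cylinders_setI).
move: A; apply: smallest_sub; last first.
  move=> _ [->|[k [u ->]]].
    have e (S : Type) (W : S -> nat -> B) : [set w | set0 (W w)] = set0.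
      by apply/seteqP; split.
    by rewrite !e !measure0.
  have m1 := measurable_agree mX k u; have m2 := measurable_agree mX' k u.
  by split => //; rewrite (prE P m1) (prE P' m2) agreeE.
split.
- by split; [exact: measurableT|exact: measurableT|rewrite !probability_setT].
- move=> A [m1 m2 e]; split; [exact: measurableC|exact: measurableC|].
  have c1 := probability_setC P m1; have c2 := probability_setC P' m2.
  by move: c1 c2; rewrite e => c1 c2; rewrite [LHS]c1 [RHS]c2.
- move=> F tF hF.
  have e (S : Type) (W : S -> nat -> B) :
      [set w | (\bigcup_n F n) (W w)] = \bigcup_n [set w | F n (W w)].
    by apply/seteqP; split => w [n _ h]; exists n.
  have m1 n : measurable [set w | F n (X ^~ w)] by case: (hF n).
  have m2 n : measurable [set w | F n (X' ^~ w)] by case: (hF n).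
  rewrite !e; split; [exact: bigcupT_measurable|exact: bigcupT_measurable|].
  have t (S : Type) (W : S -> nat -> B) : trivIset setT (fun n => [set w | F n (W w)]).
    by move=> i j _ _ [w [h1 h2]]; apply: (tF i j) => //; exists (W w).
  rewrite !measure_semi_bigcup//; [|exact: bigcupT_measurable|exact: bigcupT_measurable].
  by apply: eq_eseriesr => n _; case: (hF n).
Qed.

Lemma same_law_step_path :
  same_law P (fun w => step_path (X ^~ w)) P' (fun w => step_path (X' ^~ w)).
Proof.
by split => A /step_path_borel /sigma_cylinders_law [].
Qed.

End Laws.

End CylinderLaw.

Theorem theorem4p11 (R : realType) (V : countType) (c : V -> V -> R)
    (hG : electrical_network c) (hrec : recurrent c)
    (B : set V) (hB : B !=set0) (rho : B) :
  electrical_network (@trace_conductance R V c B) /\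
  forall (d : measure_display) (Omega : measurableType d)
    (P : probability Omega R) (Y : nat -> Omega -> V)
    (d' : measure_display) (Omega' : measurableType d')
    (P' : probability Omega' R) (Z : nat -> Omega' -> B),
    markov_chain c (val rho) P Y ->
    markov_chain (@trace_conductance R V c B) rho P' Z ->
    same_law P (fun w => step_path (trace_chain rho (fun k => Y k w)))
             P' (fun w => step_path (fun k => Z k w)).
Proof.
split; first exact: trace_network.
move=> d Omega P Y d' Omega' P' Z hY hZ.
apply: (@same_law_step_path _ _ _ _ _ _ P P'
  (fun k w => trace_chain rho (fun n => Y n w) k) Z).
- by move=> k A; exact: (measurable_trace_chain hY).
- exact: chain_measurable hZ.
- by move=> k u; exact: (pr_trace_chain hG hrec hY hZ).
Qed.
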